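(* Let $\gamma$ be an orthosymmetric and quadratically convex norm on $\mathbb{R}^n$, and let $X\subset\mathbb{R}^n$ be a nonempty convex set that is quadratically convex, orthosymmetric, and compact. Then for every $k\ge 1$, $$\frac{1}{8\sqrt{\log 3}}\,\frac{1}{\sqrt{k}}\,\sup_{x\in X}\gamma^*(x)\;\le\;\mathfrak{M}_k^{\mathsf S}(X,\gamma)\;\le\;\mathfrak{M}_k^{\mathsf R}(X,\gamma)\;\le\;\frac{1}{\sqrt{k}}\sup_{x\in X}\gamma^*(x).$$ Moreover, if $X$ is a body (has nonempty interior), there exists $\lambda^*\in\mathbb{R}^n_+$ with positive entries (possibly depending on $k$) such that the diagonally scaled gradient method with scaling $\lambda^*$ achieves this rate: its average regret over $k$ rounds, relative to $X$, is at most $\frac{1}{\sqrt{k}}\sup_{x\in X}\gamma^*(x)$ for every sequence of losses $F(\cdot,s_1),\dots,F(\cdot,s_k)$ with $F\in\mathcal{F}^{\gamma,1}$.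
   Context: A set $C\subset\mathbb{R}^n$ is orthosymmetric if $x\in C$ and $\sigma\in\{\pm1\}^n$ imply $(\sigma_jx_j)_j\in C$; it is quadratically convex if $C^2=\{(x_j^2)_j: x\in C\}$ is convex. A norm $\gamma$ is orthosymmetric if $\gamma((\sigma_jv_j)_j)=\gamma(v)$ for all $\sigma\in\{\pm1\}^n$, and quadratically convex if its unit ball is quadratically convex. $\gamma^*(z)=\sup_{\gamma(x)\le1}x^\top z$ is the dual norm. For a measurable sample space $\mathcal{S}$, $\mathcal{F}^{\gamma,1}$ denotes the functions $F:\mathbb{R}^n\times\mathcal{S}\to\mathbb{R}$, convex in the first argument and measurable in the second, such that $\gamma(g)\le1$ for all $x\in\mathbb{R}^n$, $s\in\mathcal{S}$, $g\in\partial_xF(x,s)$. For a distribution $P$ on $\mathcal{S}$ with $F(x,\cdot)$ $P$-integrable for all $x$, $f_P(x)=\int F(x,s)\,dP(s)$. The minimax stochastic risk is $$\mathfrak{M}^{\mathsf S}_k(X,\gamma)=\sup_{\mathcal{S}}\inf_{\hat x_k}\sup_{F\in\mathcal{F}^{\gamma,1}}\sup_{P}\ \mathbb{E}\Big[f_P(\hat x_k)-\inf_{x\in X}f_P(x)\Big],$$ where $\hat x_k$ is any $\mathbb{R}^n$-valued rule based on the observed functions $F(\cdot,S_1),\dots,F(\cdot,S_k)$, $S_i$ i.i.d. from $P$ (measurable in the samples for each $F$). The average minimax regret is $$\mathfrak{M}^{\mathsf R}_k(X,\gamma)=\sup_{\mathcal{S}}\inf_{\hat x_{1:k}}\sup_{F\in\mathcal{F}^{\gamma,1},\,s_1^k\in\mathcal{S}^k}\sup_{x\in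 X}\frac1k\sum_{i=1}^k\big[F(\hat x_i,s_i)-F(x,s_i)\big],$$ where $\hat x_i\in\mathbb{R}^n$ is chosen as a function of $F(\cdot,s_1),\dots,F(\cdot,s_{i-1})$ (measurable in the samples for each $F$). Estimates and plays may lie outside $X$. The diagonally scaled gradient method with scaling $\lambda\succ0$ is online mirror descent with $h(x)=\frac12x^\top\mathrm{diag}(\lambda)x$ started at $0$: $x_1=0$, $x_{i+1}=x_i-\mathrm{diag}(\lambda)^{-1}g_i$ with $g_i\in\partial_xF(x_i,s_i)$. Its average regret relative to $X$ is $\sup_{x\in X}\frac1k\sum_{i\le k}[F(x_i,s_i)-F(x,s_i)]$. *)

(* Defs.v *)
From HB Require Import structures.
From mathcomp Require Import all_boot all_order all_algebra.
From mathcomp Require Import all_classical all_reals all_analysis.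

Set Implicit Arguments.
Unset Strict Implicit.
Unset Printing Implicit Defensive.

Import Order.TTheory GRing.Theory Num.Theory.
Import numFieldNormedType.Exports.

Local Open Scope classical_set_scope.
Local Open Scope ring_scope.

Section geometry.
Context {R : realType} {n : nat}.
Implicit Types (x z v g : 'rV[R]_n) (C X : set 'rV[R]_n).
Implicit Types (gamma : 'rV[R]_n -> R).

Definition dotp x z : R := (x *m z^T) 0 0.

Definition flip_signs (sigma : 'I_n -> bool) x : 'rV[R]_n :=
  \row_j ((-1) ^+ sigma j * x 0 j).

Definition orthosymmetric C : Prop :=
  forall sigma x, C x -> C (flip_signs sigma x).

Definition convex_subset C : Prop :=
  convex_set (C : set (convex_lmodType 'rV[R]_n)).

Definition quadratically_convex C : Prop :=
  convex_subset [set \row_j (x 0 j ^+ 2) | x in C].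

Record is_norm gamma : Prop := IsNorm {
  is_norm_triangle : forall x v, gamma (x + v) <= gamma x + gamma v ;
  is_norm_homogeneous : forall (a : R) x, gamma (a *: x) = `|a| * gamma x ;
  is_norm_definite : forall x, gamma x = 0 -> x = 0 }.

Definition unit_ball gamma : set 'rV[R]_n := [set x | gamma x <= 1].

Definition orthosymmetric_norm gamma : Prop :=
  forall sigma v, gamma (flip_signs sigma v) = gamma v.

Definition quadratically_convex_norm gamma : Prop :=
  quadratically_convex (unit_ball gamma).

(* For a norm on 'rV_n the unit ball is bounded, so the real supremum is the
   true one; likewise below for the supremum over a nonempty compact [X]. *)
Definition dual_norm gamma z : R := sup [set dotp x z | x in unit_ball gamma].

Definition dual_radius gamma X : R := sup [set dual_norm gamma x | x in X].

Definition subdifferential (f : 'rV[R]_n -> R) x : set 'rV[R]_n :=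
  [set g | forall y, f x + dotp g (y - x) <= f y].

Definition loss_class gamma d (S : measurableType d) :
    set ('rV[R]_n -> S -> R) :=
  [set F | [/\ forall s, convex_function
                 [set: convex_lmodType 'rV[R]_n] (fun x => F x s),
               forall x, measurable_fun [set: S] (F x) &
               forall x s g, subdifferential (F^~ s) x g -> gamma g <= 1]].

(* Measurability for the Borel sigma-algebra of R^n. *)
Definition measurable_vec d (T : measurableType d) (f : T -> 'rV[R]_n) : Prop :=
  forall j, measurable_fun [set: T] (fun t => f t 0 j).

Definition observed k d (S : measurableType d) (F : 'rV[R]_n -> S -> R)
    (s : k.-tuple S) : k.-tuple ('rV[R]_n -> R) :=
  map_tuple (fun w => F^~ w) s.

End geometry.

Section iid_law.
Context {d : measure_display} {S : measurableType d} {R : realType}.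

Definition cons_sample k (p : S * k.-tuple S) : k.+1.-tuple S :=
  [tuple of p.1 :: p.2].

Lemma measurable_cons_sample k :
  measurable_fun [set: S * k.-tuple S] (@cons_sample k).
Proof. exact: measurable_cons. Qed.

HB.instance Definition _ k :=
  isMeasurableFun.Build _ _ _ _ (@cons_sample k) (@measurable_cons_sample k).

(* The k-fold product of [P], i.e. the law of k i.i.d. samples from [P]. *)
Fixpoint iid_law (P : probability S R) k : probability (k.-tuple S) R :=
  match k with
  | 0 => \d_[tuple]
  | k'.+1 => distribution (P \x iid_law P k')%E (@cons_sample k')
  end.

Lemma iid_lawE (P : probability S R) k (A : 'I_k -> set S) :
  (forall i, measurable (A i)) ->
  iid_law P k [set s | forall i, A i (tnth s i)] = (\prod_(i < k) P (A i))%E.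
Proof.
elim: k A => [|k IH] A mA.
  rewrite big_ord0 /= diracE mem_set//= => -[//].
rewrite big_ord_recl /= -IH//.
rewrite /distribution /pushforward.
have -> : @cons_sample k @^-1` [set s | forall i, A i (tnth s i)] =
    A ord0 `*` [set s | forall i, A (lift ord0 i) (tnth s i)].
  apply/seteqP; split => [[a s] /= h|[a s] /= [h0 h] i].
    split; first by have := h ord0; rewrite tnth0.
    by move=> i; have := h (lift ord0 i); rewrite tnthS.
  by case: (unliftP ord0 i) => [j ->|->]; rewrite ?tnth0 ?tnthS //; exact: h.
rewrite product_measure1E//.
rewrite [X in measurable X](_ : _ =
    \bigcap_(i in [set: 'I_k]) ((@tnth _ S)^~ i @^-1` A (lift ord0 i)));
  last first.
  by apply/seteqP; split => s /= h i => [_|]; exact: h.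
apply: fin_bigcap_measurable => // i _.
by rewrite -[X in measurable X]setTI; exact: measurable_tnth.
Qed.

End iid_law.

Section minimax.
Context {R : realType} {n : nat}.
Variables (k : nat) (X : set 'rV[R]_n) (gamma : 'rV[R]_n -> R).

Let E := 'rV[R]_n.

(* [E[Z]], set to [+oo] when neither the positive nor the negative part of [Z]
   is integrable; in that case [\int] alone would return [-oo]. *)
Definition expected_value d (T : measurableType d) (Q : probability T R)
    (Z : T -> \bar R) : \bar R :=
  (if \int[Q]_w (Z^\+ w) == +oo then +oo else \int[Q]_w Z w)%E.

Definition mean_loss d (S : measurableType d) (P : probability S R)
    (F : E -> S -> R) (x : E) : R := \int[P]_s F x s.

Definition estimator_rule d (S : measurableType d) :
    set (k.-tuple (E -> R) -> E) :=
  [set xhat | forall F : E -> S -> R, loss_class gamma F ->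
     measurable_vec (fun s : k.-tuple S => xhat (observed F s))].

Definition excess_risk d (S : measurableType d) (xhat : k.-tuple (E -> R) -> E)
    (F : E -> S -> R) (P : probability S R) : \bar R :=
  expected_value (iid_law P k) (fun s =>
    (mean_loss P F (xhat (observed F s)))%:E
    - ereal_inf [set (mean_loss P F x)%:E | x in X])%E.

Definition worst_excess_risk d (S : measurableType d)
    (xhat : k.-tuple (E -> R) -> E) : \bar R :=
  ereal_sup [set r | exists (F : E -> S -> R) (P : probability S R),
    [/\ loss_class gamma F,
        forall x, P.-integrable [set: S] (EFin \o F x) &
        r = excess_risk xhat F P]].

Definition minimax_stochastic_risk : \bar R :=
  ereal_sup [set r | exists (d : measure_display) (S : measurableType d),
    r = ereal_inf [set worst_excess_risk S xhat | xhat in estimator_rule S]].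

Definition average_regret (losses : 'I_k -> E -> R) (plays : 'I_k -> E) :
    \bar R :=
  ereal_sup [set (k%:R^-1 * \sum_(i < k) (losses i (plays i) - losses i x))%:E
            | x in X].

(* A strategy maps the history of observed functions to the next play; the
   play of round [i] (counted from 0) sees the first [i] functions only. *)
Definition strategy_play d (S : measurableType d) (xhat : seq (E -> R) -> E)
    (F : E -> S -> R) (s : k.-tuple S) (i : 'I_k) : E :=
  xhat (take i (observed F s)).

Definition strategy_rule d (S : measurableType d) : set (seq (E -> R) -> E) :=
  [set xhat | forall F : E -> S -> R, loss_class gamma F ->
     forall i, measurable_vec (fun s : k.-tuple S => strategy_play xhat F s i)].

Definition worst_regret d (S : measurableType d) (xhat : seq (E -> R) -> E) :
    \bar R :=
  ereal_sup [set r | exists (F : E -> S -> R) (s : k.-tuple S),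
    loss_class gamma F /\
    r = average_regret (fun i => F^~ (tnth s i)) (strategy_play xhat F s)].

Definition minimax_regret : \bar R :=
  ereal_sup [set r | exists (d : measure_display) (S : measurableType d),
    r = ereal_inf [set worst_regret S xhat | xhat in strategy_rule S]].

(* Rounds are counted from 0; only [x i] and [g i] with [i < k] matter. *)
Definition scaled_gradient_run (lambda : E) (losses : 'I_k -> E -> R)
    (x g : nat -> E) : Prop :=
  x 0%N = 0 /\
  forall i : 'I_k, subdifferential (losses i) (x i) (g i) /\
    x i.+1 = x i - g i *m invmx (diag_mx lambda).

End minimax.

(* Main.v *)
Require Import Defs.
From mathcomp Require Import all_boot all_order all_algebra.
From mathcomp Require Import all_classical all_reals all_analysis.
From mathcomp Require Import measurable_realfun.
From mathcomp Require Import ring lra.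

Set Implicit Arguments.
Unset Strict Implicit.
Unset Printing Implicit Defensive.

Import Order.TTheory GRing.Theory Num.Theory.
Import numFieldNormedType.Exports.

Local Open Scope classical_set_scope.
Local Open Scope ring_scope.

(** Throughout, [D] stands for [dual_radius gamma X], the supremum of [<g, x>]
  over [x] in [X] and [gamma g <= 1]. By sign symmetry it is also the supremum
  of [sum_j |x_j| |g_j|].

  Lower bound. Fix [x] in [X] and [g] in the unit ball with [A := <g, x> >= 0].
  The losses [|<g, y> - w A|] with [w = 1] or [w = -1] only have subgradients
  [t g] with [|t| <= 1], so they are admissible. If [w] is drawn from a coin of
  bias [delta] towards one of the signs, one of [x] and [-x] is better than the
  other by [2 delta A], and [k] flips of the coin hardly reveal the direction of
  the bias when [delta = 1 / (2 sqrt k)]: [coin_mean_difference] bounds the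
  distance of the two laws through the second moment of the difference of their
  likelihood ratios. So every estimator loses a constant times
  [A / sqrt k] for one of the two coins. This is a one-dimensional problem with
  two hypotheses, for all [n]; the supremum over [x] and [g] turns [A] into [D].

  Risk and regret. The average of the plays of an online strategy is an
  estimator whose excess risk is at most the worst-case average regret: convexity
  bounds the risk of the average play, and conditionally on the past the loss of
  a play has the mean loss of that play as its expectation. The expectations
  must exist for this. They do when the strategy is run on [S * nat]
  instead of [S]: there every sequence of admissible losses is realized by some
  loss, so that a strategy of finite worst-case regret has bounded plays
  ([strategy_plays_bounded]), whereas a strategy on [S] itself could have
  unbounded ones. Integrating one sample at a time ([expected_regret_le]) then
  gives the inequality.

  Upper bounds. With the scaling [sqrt k * mu], the standard potential argument
  bounds the average regret of the scaled gradient method by [1 / (2 sqrt k)]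
  times the supremum over [x] and [g] of
  [scaling_cost x g mu = sum_j (mu_j x_j^2 + g_j^2 / mu_j)]. For fixed [x] and
  [g] the infimum of this cost over [mu] is [2 sum_j |x_j| |g_j| <= 2 D]. A single
  [mu] serves all [x] and [g] because the sets of the vectors [(x_j^2)_j] and
  [(g_j^2)_j] are convex, on which [sum_j sqrt (x_j^2) * sqrt (g_j^2)] is a
  concave function: the first-order conditions at a maximizer [(a, b)] say
  that [mu_j = |b_j| / |a_j|] works. Adding [tau^2] to all the squares keeps
  [mu] positive at a cost of order [tau] ([near_optimal_scaling]); if [X] has an
  interior point, these scalings stay in a compact set of positive vectors and
  have a limit point of cost at most [2 D] ([optimal_scaling]). A strategy
  must moreover be a measurable function of the samples, so it picks the first
  rational vector in a fixed enumeration that is a subgradient up to a small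
  error; the errors vanish in the infimum over strategies. *)

(** * Dot products and subgradients of convex functions *)

Section dot_product.
Context {R : realType} {n : nat}.
Implicit Types x y z : 'rV[R]_n.

Lemma dotpE x z : dotp x z = \sum_j x 0 j * z 0 j.
Proof. by rewrite /dotp mxE; apply: eq_bigr => j _; rewrite mxE. Qed.

Lemma dotpC x z : dotp x z = dotp z x.
Proof. by rewrite !dotpE; apply: eq_bigr => j _; rewrite mulrC. Qed.

Lemma dotpDr x y z : dotp x (y + z) = dotp x y + dotp x z.
Proof. by rewrite /dotp linearD mulmxDr mxE. Qed.

Lemma dotpZr (a : R) x z : dotp x (a *: z) = a * dotp x z.
Proof. by rewrite /dotp linearZ -scalemxAr mxE. Qed.

Lemma dotpNr x z : dotp x (- z) = - dotp x z.
Proof. by rewrite -scaleN1r dotpZr mulN1r. Qed.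

Lemma dotpBr x y z : dotp x (y - z) = dotp x y - dotp x z.
Proof. by rewrite dotpDr dotpNr. Qed.

Lemma dotpDl x y z : dotp (x + y) z = dotp x z + dotp y z.
Proof. by rewrite dotpC dotpDr !(dotpC z). Qed.

Lemma dotpZl (a : R) x z : dotp (a *: x) z = a * dotp x z.
Proof. by rewrite dotpC dotpZr dotpC. Qed.

Lemma dotpNl x z : dotp (- x) z = - dotp x z.
Proof. by rewrite dotpC dotpNr dotpC. Qed.

Lemma dotp0r x : dotp x 0 = 0.
Proof. by rewrite -(scale0r x) dotpZr mul0r. Qed.

Lemma dotp0l x : dotp 0 x = 0.
Proof. by rewrite dotpC dotp0r. Qed.

Lemma dotp_ge0 x : 0 <= dotp x x.
Proof. by rewrite dotpE sumr_ge0// => j _; rewrite -expr2 sqr_ge0. Qed.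

Lemma dotp_eq0 x : dotp x x <= 0 -> x = 0.
Proof.
move=> x0; apply/rowP => j; rewrite mxE.
have /eqP : dotp x x = 0 by apply/eqP; rewrite eq_le x0 dotp_ge0.
rewrite dotpE psumr_eq0; last by move=> i _; rewrite -expr2 sqr_ge0.
by move/allP/(_ j); rewrite mem_index_enum => /(_ isT); rewrite -expr2 sqrf_eq0 => /eqP.
Qed.

End dot_product.

Section convexity.
Context {R : realType} {n : nat}.
Implicit Types (x y e u v : 'rV[R]_n) (f p : 'rV[R]_n -> R).

Definition convex_fun f : Prop := forall x y (t : R), 0 <= t <= 1 ->
  f (t *: x + (1 - t) *: y) <= t * f x + (1 - t) * f y.

Lemma convex_functionP f :
  convex_function [set: convex_lmodType 'rV[R]_n] f <-> convex_fun f.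
Proof.
split=> [cf x y t /andP[t0 t1]|cf t x y _ _]; last by apply: cf; apply/andP.
by have /= := cf (Itv01 t0 t1) x y; apply; rewrite inE.
Qed.

Lemma convex_subsetP (C : set 'rV[R]_n) x y (t : R) :
  convex_subset C -> 0 <= t <= 1 -> C x -> C y -> C (t *: x + (1 - t) *: y).
Proof.
move=> cC /andP[t0 t1] Cx Cy.
have := cC x y (Itv01 t0 t1); rewrite !in_setE => /(_ Cx Cy); exact.
Qed.

(** One step of the Hahn-Banach argument: the slope [c] of a supporting line of
  [p] at [0] in the direction [e] is fixed, and minimizing [p - c t] along the
  lines of direction [e] leaves a convex minorant that is affine along [e]. *)
Lemma convex_minorant_affine_along p e : convex_fun p -> p 0 = 0 ->
  exists (q : 'rV[R]_n -> R) (c : R), [/\ convex_fun q, q 0 = 0,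
    forall v, q v <= p v,
    forall v t, q (v + t *: e) = q v + t * c &
    forall u a, (forall v t, p (v + t *: u) = p v + t * a) ->
      forall v t, q (v + t *: u) = q v + t * a].
Proof.
move=> cp p0.
pose A := [set p (t *: e) / t | t in [set t : R | 0 < t]].
have A_lb (s t : R) : 0 < s -> 0 < t -> - p (- s *: e) / s <= p (t *: e) / t.
  move=> s0 t0; have st0 : 0 < s + t by rewrite addr_gt0.
  have t01 : 0 <= t / (s + t) <= 1.
    apply/andP; split; first by rewrite divr_ge0 ?ltW.
    by rewrite ler_pdivrMr// mul1r lerDr ltW.
  have := cp (- s *: e) (t *: e) (t / (s + t)) t01.
  rewrite !scalerA -scalerDl.
  have -> : t / (s + t) * - s + (1 - t / (s + t)) * t = 0.
    by field; rewrite gt_eqF.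
  rewrite scale0r p0.
  have -> : t / (s + t) * p (- s *: e) + (1 - t / (s + t)) * p (t *: e) =
      (t * p (- s *: e) + s * p (t *: e)) / (s + t).
    by field; rewrite gt_eqF.
  rewrite pmulr_lge0 ?invr_gt0// => h.
  by rewrite ler_pdivrMr// mulrAC ler_pdivlMr//; lra.
have A0 : A !=set0 by exists (p (1 *: e) / 1), 1 => //=.
have A_hlb : has_lbound A.
  by exists (- p (- 1 *: e) / 1) => _ [t t0 <-]; exact: A_lb.
pose c := inf A.
have c_slope t : t * c <= p (t *: e).
  case: (ltrgtP t 0) => [t0|t0|->]; last by rewrite mul0r scale0r p0.
    have Nt0 : 0 < - t by rewrite oppr_gt0.
    have : - p (- - t *: e) / (- t) <= c.
      by apply: lb_le_inf => // _ [s s0 <-]; exact: A_lb.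
    rewrite opprK invrN mulrN mulNr opprK ler_ndivrMr//.
    by rewrite mulrC.
  by rewrite mulrC -ler_pdivlMr//; apply: ge_inf => //; exists t.
pose B v := [set p (v + t *: e) - t * c | t in [set: R]].
have B0 v : B v !=set0 by exists (p (v + 0 *: e) - 0 * c), 0.
have B_lb v : has_lbound (B v).
  exists (- p (- v)) => _ [t _ <-].
  have h2 : 0 <= (2^-1 : R) <= 1 by lra.
  have := cp (v + t *: e) (- v) _ h2.
  have -> : 2^-1 *: (v + t *: e) + (1 - 2^-1) *: - v = (t / 2) *: e.
    by apply/rowP => j; rewrite !mxE; field.
  by have := c_slope (t / 2); lra.
pose q v := inf (B v).
have qle v t : q v <= p (v + t *: e) - t * c by apply: ge_inf => //; exists t.
have leq v a : (forall t, a <= p (v + t *: e) - t * c) -> a <= q v.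
  by move=> h; apply: lb_le_inf => // _ [t _ <-].
exists q, c; split.
- move=> x y t /andP[t0 t1].
  have main a b : q (t *: x + (1 - t) *: y) <=
      t * (p (x + a *: e) - a * c) + (1 - t) * (p (y + b *: e) - b * c).
    apply: (le_trans (qle _ (t * a + (1 - t) * b))).
    have := cp (x + a *: e) (y + b *: e) t; rewrite t0 t1 => /(_ isT).
    have -> : t *: (x + a *: e) + (1 - t) *: (y + b *: e) =
        t *: x + (1 - t) *: y + (t * a + (1 - t) * b) *: e.
      by apply/rowP => j; rewrite !mxE; ring.
    lra.
  have step (s C L : R) v : 0 <= s ->
      (forall a, L <= s * (p (v + a *: e) - a * c) + C) -> L <= s * q v + C.
    rewrite le_eqVlt => /predU1P[<- /(_ 0)|s0 h]; first by rewrite !mul0r.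
    rewrite -lerBlDr mulrC -ler_pdivrMr//; apply: leq => a.
    by rewrite ler_pdivrMr// lerBlDr mulrC.
  apply: (step) => // a; rewrite [leRHS]addrC.
  apply: (step) => [|b]; first by rewrite subr_ge0.
  by rewrite [leRHS]addrC.
- apply/eqP; rewrite eq_le; apply/andP; split.
    by have := qle 0 0; rewrite scale0r addr0 p0 mul0r subr0.
  by apply: leq => t; rewrite add0r subr_ge0.
- by move=> v; have := qle v 0; rewrite scale0r addr0 mul0r subr0.
- have h v t : q (v + t *: e) <= q v + t * c.
    rewrite -lerBlDr; apply: leq => a; rewrite lerBlDr.
    apply: (le_trans (qle _ (a - t))).
    by rewrite -addrA -scalerDl subrKC; lra.
  move=> v t; apply/eqP; rewrite eq_le h /=.
  have := h (v + t *: e) (- t); rewrite -addrA -scalerDl subrr scale0r addr0.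
  lra.
- move=> u a pu.
  have h v t : q (v + t *: u) <= q v + t * a.
    rewrite -lerBlDr; apply: leq => b; rewrite lerBlDr.
    apply: (le_trans (qle _ b)).
    by rewrite addrAC pu; lra.
  move=> v t; apply/eqP; rewrite eq_le h /=.
  have := h (v + t *: u) (- t); rewrite -addrA -scalerDl subrr scale0r addr0.
  lra.
Qed.

Lemma subgradient_exists f x : convex_fun f -> exists g, subdifferential f x g.
Proof.
move=> cf; pose p v := f (x + v) - f x.
have cp : convex_fun p.
  move=> u v t t01; rewrite /p.
  have -> : x + (t *: u + (1 - t) *: v) = t *: (x + u) + (1 - t) *: (x + v).
    by apply/rowP => j; rewrite !mxE; ring.
  by have := cf (x + u) (x + v) t t01; lra.
have p0 : p 0 = 0 by rewrite /p addr0 subrr.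
have step (js : seq 'I_n) : exists q : 'rV[R]_n -> R,
    [/\ convex_fun q, q 0 = 0, forall v, q v <= p v &
     forall j, j \in js -> exists c, forall v t,
       q (v + t *: delta_mx 0 j) = q v + t * c].
  elim: js => [|j js [q [cq q0 qp qjs]]]; first by exists p.
  have [q' [c [cq' q'0 q'q q'j q'js]]] :=
    convex_minorant_affine_along (delta_mx 0 j) cq q0.
  exists q'; split => // [v|i]; first exact: (le_trans (q'q v)).
  rewrite inE => /predU1P[->|/qjs[a qa]]; first by exists c.
  by exists a; exact: q'js.
have [q [_ q0 qp qj]] := step (enum 'I_n).
have /choice[c qc] : forall j, exists c, forall v t,
    q (v + t *: delta_mx 0 j) = q v + t * c.
  by move=> j; apply: qj; rewrite mem_enum.
exists (\row_j c j) => y.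
have : q (y - x) = dotp (\row_j c j) (y - x).
  rewrite dotpE [X in q X]row_sum_delta.
  elim/big_rec2 : _ => [//|j a v _ <-].
  by rewrite [X in q X]addrC qc !mxE; ring.
have := qp (y - x); rewrite /p subrKC => h1 h2.
by rewrite -h2; lra.
Qed.

End convexity.

(** * Orthosymmetric norms and the dual radius *)

Lemma continuous_fsum {R : realType} (T : topologicalType) (I : Type)
    (r : seq I) (f : I -> T -> R) :
  (forall i, continuous (f i)) -> continuous (fun x => \sum_(i <- r) f i x).
Proof.
by move=> cf; apply: continuous_big => [|i _]; [exact: add_continuous|exact: cf].
Qed.

Lemma continuous_coord_comp {R : realType} n (phi : R -> R) (j : 'I_n) :
  continuous phi -> continuous (fun y : 'rV[R]_n => phi (y 0 j)).
Proof.
move=> cphi y; apply: (@continuous_comp _ _ _ (fun y : 'rV[R]_n => y 0 j)).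
  exact: coord_continuous.
exact: cphi.
Qed.

Section orthosymmetric_norms.
Context {R : realType} {n : nat}.
Variables (gamma : 'rV[R]_n -> R) (gamma_norm : is_norm gamma).
Implicit Types (x y g : 'rV[R]_n).

Lemma norm_zero : gamma 0 = 0.
Proof. by rewrite -(scale0r 0) (is_norm_homogeneous gamma_norm) normr0 mul0r. Qed.

Lemma norm_opp x : gamma (- x) = gamma x.
Proof. by rewrite -scaleN1r (is_norm_homogeneous gamma_norm) normrN1 mul1r. Qed.

Lemma norm_nonneg x : 0 <= gamma x.
Proof.
have := is_norm_triangle gamma_norm x (- x).
by rewrite subrr norm_zero norm_opp; lra.
Qed.

Lemma norm_delta_gt0 j : 0 < gamma (delta_mx 0 j).
Proof.
rewrite lt_neqAle norm_nonneg andbT; apply/eqP => /esym/(is_norm_definite gamma_norm).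
by move/rowP/(_ j); rewrite !mxE !eqxx /= => /eqP; rewrite oner_eq0.
Qed.

Lemma norm_le_coords x : gamma x <= \sum_j `|x 0 j| * gamma (delta_mx 0 j).
Proof.
rewrite {1}[x]row_sum_delta.
elim/big_rec2 : _ => [|j a v _ h]; first by rewrite norm_zero.
apply: (le_trans (is_norm_triangle gamma_norm _ _)).
by rewrite (is_norm_homogeneous gamma_norm) lerD2l.
Qed.

Hypothesis gamma_orthosymmetric : orthosymmetric_norm gamma.

(** Averaging [x] with its image under the sign flip that fixes only the
  [j]-th coordinate leaves that coordinate alone. *)
Lemma coord_le_norm x j : `|x 0 j| * gamma (delta_mx 0 j) <= gamma x.
Proof.
rewrite -(is_norm_homogeneous gamma_norm).
have -> : x 0 j *: delta_mx 0 j = 2^-1 *: x + 2^-1 *: flip_signs (fun i => i != j) x.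
  apply/rowP => i; rewrite !mxE eqxx /=; case: eqVneq => [->|_] /=.
    by rewrite expr0; field.
  by rewrite expr1; field.
apply: (le_trans (is_norm_triangle gamma_norm _ _)).
rewrite !(is_norm_homogeneous gamma_norm) gamma_orthosymmetric ger0_norm//.
by lra.
Qed.

(** An upper bound of the dual norm, explicit enough for Lipschitz estimates. *)
Definition weighted_l1 x : R := \sum_j `|x 0 j| / gamma (delta_mx 0 j).

Lemma weighted_l1_ge0 x : 0 <= weighted_l1 x.
Proof. by apply: sumr_ge0 => j _; rewrite divr_ge0// norm_nonneg. Qed.

Lemma ball_coord_le g j : gamma g <= 1 -> `|g 0 j| <= (gamma (delta_mx 0 j))^-1.
Proof.
move=> g1; rewrite -[leRHS]mul1r ler_pdivlMr ?norm_delta_gt0//.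
exact: le_trans (coord_le_norm _ _) g1.
Qed.

Lemma dotp_le_weighted_l1 g x : gamma g <= 1 -> dotp g x <= weighted_l1 x.
Proof.
move=> g1; rewrite dotpE; apply: ler_sum => j _.
apply: (le_trans (ler_norm _)); rewrite normrM mulrC.
by apply: ler_wpM2l => //; exact: ball_coord_le.
Qed.

Lemma weighted_l1N x : weighted_l1 (- x) = weighted_l1 x.
Proof. by apply: eq_bigr => j _; rewrite mxE normrN. Qed.

Lemma weighted_l1D x y : weighted_l1 (x + y) <= weighted_l1 x + weighted_l1 y.
Proof.
rewrite -big_split; apply: ler_sum => j _ /=.
by rewrite -mulrDl ler_pM2r ?invr_gt0 ?norm_delta_gt0// mxE ler_normD.
Qed.

Lemma normalized_delta_in_ball j :
  gamma ((gamma (delta_mx 0 j))^-1 *: delta_mx 0 j) <= 1.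
Proof.
rewrite (is_norm_homogeneous gamma_norm) ger0_norm ?invr_ge0 ?norm_nonneg//.
by rewrite mulVf// gt_eqF// norm_delta_gt0.
Qed.

Lemma norm_continuous : continuous (gamma : ('rV[R]_n : topologicalType) -> R).
Proof.
move=> x; pose c y : R := \sum_j `|y 0 j - x 0 j| * gamma (delta_mx 0 j).
have c_cvg : c y @[y --> x] --> (0 : R).
  have <- : c x = 0 by apply: big1 => j _; rewrite subrr normr0 mul0r.
  apply: (@continuous_fsum R 'rV[R]_n) => j.
  apply: (continuous_coord_comp (phi := fun a => `|a - x 0 j| * _)) => a.
  apply: cvgM; last exact: cvg_cst.
  by apply: cvg_norm; apply: cvgB; [exact: cvg_id|exact: cvg_cst].
have gap y : `|gamma x - gamma y| <= c y.
  have cE : gamma (y - x) <= c y.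
    apply: (le_trans (norm_le_coords _)).
    by apply: ler_sum => j _; rewrite !mxE.
  have := is_norm_triangle gamma_norm x (y - x).
  have := is_norm_triangle gamma_norm y (x - y).
  rewrite !subrKC -(norm_opp (x - y)) opprB ler_norml; lra.
apply/(@cvgrPdist_le R R^o _ (nbhs x) (nbhs_filter x) gamma (gamma x)) => e e0.
move/(@cvgrPdist_le R R^o _ (nbhs x) (nbhs_filter x) c 0)/(_ _ e0) : c_cvg.
apply: filterS => y; rewrite sub0r normrN; apply: le_trans.
exact: le_trans (gap y) (ler_norm _).
Qed.

Lemma unit_ball_compact : compact (unit_ball gamma).
Proof.
apply: (@subclosed_compact _ _ [set v : 'rV[R]_n | forall j,
    `[- (gamma (delta_mx 0 j))^-1, (gamma (delta_mx 0 j))^-1]%classic (v ord0 j)]).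
- rewrite (_ : unit_ball gamma = gamma @^-1` [set r | r <= 1])//.
  apply: preimage_closed; last exact: closed_le.
  by move=> x _; exact: norm_continuous.
- apply: (@rV_compact R n (fun j =>
      `[- (gamma (delta_mx 0 j))^-1, (gamma (delta_mx 0 j))^-1]%classic)) => j.
  exact: segment_compact.
- by move=> g g1 j /=; rewrite in_itv/= -ler_norml; exact: ball_coord_le.
Qed.

End orthosymmetric_norms.

Section dual_radius.
Context {R : realType} {n : nat}.
Variables (gamma : 'rV[R]_n -> R) (gamma_norm : is_norm gamma).
Hypothesis gamma_orthosymmetric : orthosymmetric_norm gamma.
Variable X : set 'rV[R]_n.
Hypothesis X_compact : compact X.
Implicit Types (x y g : 'rV[R]_n).

Lemma dotp_le_dual_norm g x : gamma g <= 1 -> dotp g x <= dual_norm gamma x.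
Proof.
move=> g1; apply: ub_le_sup; last by exists g.
by exists (weighted_l1 gamma x) => _ [h h1 <-]; exact: dotp_le_weighted_l1.
Qed.

Lemma compact_coord_bounded : exists B : R, forall x j, X x -> `|x 0 j| <= B.
Proof.
have [M [_ /(_ (M + 1))]] := compact_bounded X_compact.
rewrite ltrDl ltr01 => /(_ isT) hM; exists (M + 1) => x j /hM /=.
apply: le_trans; rewrite -[leRHS]/(mx_norm x) mx_normrE.
by rewrite (le_bigmax _ (fun ij => `|x ij.1 ij.2|) (0, j)).
Qed.

Lemma weighted_l1_bounded : exists B : R, forall x, X x -> weighted_l1 gamma x <= B.
Proof.
have [B XB] := compact_coord_bounded.
exists (\sum_j B / gamma (delta_mx 0 j)) => x Xx; apply: ler_sum => j _.
by rewrite ler_pM2r ?invr_gt0 ?norm_delta_gt0// XB.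
Qed.

Lemma dotp_le_dual_radius g x : gamma g <= 1 -> X x ->
  dotp g x <= dual_radius gamma X.
Proof.
move=> g1 Xx; apply: (le_trans (dotp_le_dual_norm _ g1)).
apply: ub_le_sup; last by exists x.
have [B XB] := weighted_l1_bounded; exists B => _ [y Xy <-].
apply: ge_sup; first by exists (dotp 0 y), 0 => //=; rewrite /unit_ball/= norm_zero.
by move=> _ [h h1 <-]; exact: le_trans (dotp_le_weighted_l1 _ _ _ h1) (XB _ Xy).
Qed.

(** The signs of [g] can be matched to those of [x] without leaving the ball. *)
Lemma abs_dotp_le_dual_radius g x : gamma g <= 1 -> X x ->
  \sum_j `|x 0 j| * `|g 0 j| <= dual_radius gamma X.
Proof.
move=> g1 Xx; pose g' := flip_signs (fun j => x 0 j * g 0 j < 0) g.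
have g'1 : gamma g' <= 1 by rewrite gamma_orthosymmetric.
apply: le_trans (dotp_le_dual_radius g'1 Xx); rewrite dotpE.
apply: ler_sum => j _; rewrite mxE -normrM.
case: ltP => h; rewrite ?expr0 ?expr1.
  by rewrite ltr0_norm//; lra.
by rewrite ger0_norm//; lra.
Qed.

Lemma dual_radius_le (r : R) : X !=set0 ->
  (forall x g, X x -> gamma g <= 1 -> dotp g x <= r) -> dual_radius gamma X <= r.
Proof.
move=> [x0 X0] h; apply: ge_sup; first by exists (dual_norm gamma x0), x0.
move=> _ [x Xx <-]; apply: ge_sup.
  by exists (dotp 0 x), 0 => //=; rewrite /unit_ball/= norm_zero.
by move=> _ [g g1 <-]; exact: h.
Qed.

End dual_radius.

Section losses.
Context {R : realType} {n : nat}.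
Variables (gamma : 'rV[R]_n -> R) (gamma_norm : is_norm gamma).
Hypothesis gamma_orthosymmetric : orthosymmetric_norm gamma.
Implicit Types (x y g : 'rV[R]_n) (f : 'rV[R]_n -> R).

Definition admissible_loss f : Prop :=
  convex_fun f /\ forall x g, subdifferential f x g -> gamma g <= 1.

Lemma loss_classP d (S : measurableType d) (F : 'rV[R]_n -> S -> R) :
  loss_class gamma F <->
  (forall s, admissible_loss (F^~ s)) /\ (forall x, measurable_fun [set: S] (F x)).
Proof.
split=> [[cF mF gF]|[aF mF]].
  by split=> // s; split; [apply/convex_functionP; exact: cF|move=> x g; exact: gF].
split=> // [s|x s g]; first by apply/convex_functionP; exact: (aF s).1.
exact: (aF s).2.
Qed.

Lemma admissible_lipschitz f x y : admissible_loss f ->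
  f x - f y <= weighted_l1 gamma (x - y).
Proof.
move=> [cf gf]; have [g fg] := subgradient_exists x cf.
apply: le_trans (dotp_le_weighted_l1 gamma_norm gamma_orthosymmetric _ (gf _ _ fg)).
by have := fg y; rewrite -[y - x]opprB dotpNr; lra.
Qed.

Lemma admissible_linear g : gamma g <= 1 -> admissible_loss (dotp g).
Proof.
move=> g1; split=> [x y t _|x h hx]; first by rewrite dotpDr !dotpZr.
have : dotp (h - g) (h - g) <= 0.
  have := hx (x + (h - g)); rewrite [x + (h - g)]addrC addrK (dotpDr g (h - g)).
  by rewrite (dotpDl h) (dotpNl g); lra.
by move/dotp_eq0/eqP; rewrite subr_eq0 => /eqP ->.
Qed.

Lemma admissible_zero : admissible_loss (fun=> 0).
Proof.
have -> : (fun=> 0) = dotp 0 :> ('rV[R]_n -> R) by apply/funext => x; rewrite dotp0l.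
by apply: admissible_linear; rewrite norm_zero.
Qed.

End losses.

(** * Optimal diagonal scalings *)

Section square_root_maximization.
Context {R : realType} {n : nat}.

(** With [y = x / p], squaring reduces this to [(y - 3) * (y + 1) <= 0]; for
  [y > 3] the left-hand side is negative. *)
Lemma sqrt_ge_quadratic (p x : R) : 0 < p -> - p <= x ->
  Num.sqrt p + x / (2 * Num.sqrt p) - x ^+ 2 / (2 * p * Num.sqrt p) <=
  Num.sqrt (p + x).
Proof.
move=> p0 px; pose r := Num.sqrt p.
have r0 : 0 < r by rewrite sqrtr_gt0.
have rr : p = r ^+ 2 by rewrite sqr_sqrtr// ltW.
rewrite -/r; pose y := x / p.
have y1 : - 1 <= y by rewrite ler_pdivlMr// mulN1r.
have xE : x = y * r ^+ 2 by rewrite -rr /y divfK// gt_eqF.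
have -> : r + x / (2 * r) - x ^+ 2 / (2 * p * r) = r * (1 + y / 2 - y ^+ 2 / 2).
  by rewrite rr xE; field; rewrite gt_eqF.
have -> : Num.sqrt (p + x) = r * Num.sqrt (1 + y).
  have -> : p + x = r ^+ 2 * (1 + y) by rewrite xE rr; ring.
  by rewrite sqrtrM ?sqr_ge0// sqrtr_sqr gtr0_norm.
rewrite ler_pM2l//.
case: (lerP (1 + y / 2 - y ^+ 2 / 2) 0) => [h|h].
  by rewrite (le_trans h)// sqrtr_ge0.
rewrite -[leLHS](ger0_norm (ltW h)) -sqrtr_sqr; apply: ler_wsqrtr.
have y3 : y <= 3 by nra.
have : 0 <= y ^+ 2 * ((3 - y) * (y + 1)).
  by rewrite mulr_ge0 ?sqr_ge0// mulr_ge0; lra.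
nra.
Qed.

(** The quadratic lower bound on the square root stands in for the derivative at
  [t = 0] of [sum_j sqrt q_j * sqrt (p_j + t d_j)]: its error is of order [t^2]. *)
Lemma sqrt_first_order (p q d : 'I_n -> R) :
  (forall j, 0 < p j) -> (forall j, - p j <= d j) ->
  (forall t, 0 < t <= 1 -> \sum_j Num.sqrt (q j) * Num.sqrt (p j + t * d j) <=
    \sum_j Num.sqrt (q j) * Num.sqrt (p j)) ->
  \sum_j Num.sqrt (q j) / Num.sqrt (p j) * d j <= 0.
Proof.
move=> p0 pd h.
pose K := \sum_j Num.sqrt (q j) * (d j ^+ 2 / (p j * Num.sqrt (p j))).
have K0 : 0 <= K.
  apply: sumr_ge0 => j _; rewrite mulr_ge0 ?sqrtr_ge0// divr_ge0 ?sqr_ge0//.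
  by rewrite mulr_ge0 ?sqrtr_ge0// ltW.
set S := (X in X <= 0).
have SK t : 0 < t <= 1 -> S <= t * K.
  move=> t01; have /andP[t0 t1] := t01.
  have main : \sum_j Num.sqrt (q j) * Num.sqrt (p j) + (t * S - t ^+ 2 * K) / 2 <=
      \sum_j Num.sqrt (q j) * Num.sqrt (p j + t * d j).
    rewrite /S /K !mulr_sumr -sumrB mulr_suml -big_split /=.
    apply: ler_sum => j _; have r0 : 0 < Num.sqrt (p j) by rewrite sqrtr_gt0.
    have := @sqrt_ge_quadratic (p j) (t * d j) (p0 j).
    have -> : - p j <= t * d j.
      have := pd j; have := p0 j; nra.
    move=> /(_ isT) /(ler_wpM2l (sqrtr_ge0 (q j))); apply: le_trans.
    rewrite le_eqVlt; apply/orP; left; apply/eqP.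
    by field; rewrite !gt_eqF.
  have tSK : t * S <= t * (t * K).
    have := h t t01; move: main; rewrite expr2 -mulrA; lra.
  by move: tSK; rewrite ler_pM2l.
rewrite leNgt; apply/negP => S0.
have K1 : 0 < K + S by rewrite ltr_wpDl.
have := SK (S / (2 * (K + S))); rewrite divr_gt0 ?mulr_gt0//=.
rewrite ler_pdivrMr ?mulr_gt0// mul1r => /(_ ltac:(lra)).
rewrite mulrAC ler_pdivlMr ?mulr_gt0//; nra.
Qed.

End square_root_maximization.

Section optimal_scaling.
Context {R : realType} {n : nat}.
Implicit Types (x g : 'rV[R]_n) (C : set 'rV[R]_n).

Lemma quadratically_convex_segment C a x (t : R) : quadratically_convex C ->
  0 <= t <= 1 -> C a -> C x ->
  exists2 y, C y & forall j, y 0 j ^+ 2 = a 0 j ^+ 2 + t * (x 0 j ^+ 2 - a 0 j ^+ 2).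
Proof.
move=> qC t01 Ca Cx.
have [y Cy yE] := convex_subsetP qC t01 (ex_intro2 _ _ x Cx erefl)
  (ex_intro2 _ _ a Ca erefl).
exists y => // j; move/rowP/(_ j) : yE; rewrite !mxE => ->; ring.
Qed.

Definition sqrt_pairing (tau : R) x g : R :=
  \sum_j Num.sqrt (x 0 j ^+ 2 + tau ^+ 2) * Num.sqrt (g 0 j ^+ 2 + tau ^+ 2).

Lemma sqrt_pairing_continuous tau :
  continuous (fun z : 'rV[R]_n * 'rV[R]_n => sqrt_pairing tau z.1 z.2).
Proof.
apply: continuous_fsum => j.
have root_cont : continuous (fun y : 'rV[R]_n => Num.sqrt (y 0 j ^+ 2 + tau ^+ 2)).
  apply: (continuous_coord_comp (phi := fun a => Num.sqrt (a ^+ 2 + tau ^+ 2))) => a.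
  apply: (@continuous_comp R R R (fun b : R => b ^+ 2 + tau ^+ 2) Num.sqrt).
    apply: cvgD; last exact: cvg_cst.
    exact: exprn_continuous.
  exact: sqrt_continuous.
pose root (y : 'rV[R]_n) := Num.sqrt (y 0 j ^+ 2 + tau ^+ 2).
move=> z; apply: cvgM.
  apply: (@continuous_comp ('rV[R]_n * 'rV[R]_n)%type 'rV[R]_n R fst root z).
    exact: cvg_fst.
  exact: root_cont.
apply: (@continuous_comp ('rV[R]_n * 'rV[R]_n)%type 'rV[R]_n R snd root z).
  exact: cvg_snd.
exact: root_cont.
Qed.

(** At a maximizer of [sqrt_pairing tau] over [X * G], twice the gradient of the
  pairing with respect to the squared coordinates of [x] is a scaling, and its
  coordinatewise inverse is twice the gradient with respect to those of [g]. *)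
Lemma regularized_scaling_exists (X G : set 'rV[R]_n) (tau M : R) :
  X !=set0 -> G !=set0 -> compact X -> compact G ->
  quadratically_convex X -> quadratically_convex G -> 0 < tau ->
  (forall x g, X x -> G g -> sqrt_pairing tau x g <= M) ->
  exists mu : 'rV[R]_n, (forall j, 0 < mu 0 j) /\
    forall x g, X x -> G g ->
      \sum_j (mu 0 j * x 0 j ^+ 2 + g 0 j ^+ 2 / mu 0 j) <= 2 * M.
Proof.
move=> [x0 Xx0] [g0 Gg0] cX cG qX qG tau0 hM.
have XG0 : X `*` G !=set0 by exists (x0, g0).
have [[a b] /set_mem[/= Xa Gb] abmax] := compact_EVT_max XG0 (compact_setX cX cG)
  (continuous_subspaceT (sqrt_pairing_continuous (tau := tau))).
have tau2 : 0 < tau ^+ 2 by rewrite exprn_gt0.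
have reg_gt0 (r : R) : 0 < r ^+ 2 + tau ^+ 2 by rewrite ltr_wpDl// sqr_ge0.
pose p j := a 0 j ^+ 2 + tau ^+ 2; pose q j := b 0 j ^+ 2 + tau ^+ 2.
have p0 j : 0 < p j by exact: reg_gt0.
have q0 j : 0 < q j by exact: reg_gt0.
have sp0 j : 0 < Num.sqrt (p j) by rewrite sqrtr_gt0.
have sq0 j : 0 < Num.sqrt (q j) by rewrite sqrtr_gt0.
have Xopt x : X x -> \sum_j Num.sqrt (q j) / Num.sqrt (p j) *
    (x 0 j ^+ 2 - a 0 j ^+ 2) <= 0.
  move=> Xx; apply: sqrt_first_order => // [j|t /andP[t0 t1]].
    by rewrite /p; have := sqr_ge0 (x 0 j); lra.
  have [|y Xy yE] := quadratically_convex_segment (t := t) qX _ Xa Xx.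
    by rewrite ltW.
  have := abmax (y, b); rewrite inE => /(_ (conj Xy Gb)).
  rewrite /sqrt_pairing /=; under eq_bigr do rewrite yE mulrC addrAC.
  by move/le_trans; apply; apply: ler_sum => j _; rewrite mulrC.
have Gopt g : G g -> \sum_j Num.sqrt (p j) / Num.sqrt (q j) *
    (g 0 j ^+ 2 - b 0 j ^+ 2) <= 0.
  move=> Gg; apply: sqrt_first_order => // [j|t /andP[t0 t1]].
    by rewrite /q; have := sqr_ge0 (g 0 j); lra.
  have [|y Gy yE] := quadratically_convex_segment (t := t) qG _ Gb Gg.
    by rewrite ltW.
  have := abmax (a, y); rewrite inE => /(_ (conj Xa Gy)).
  by rewrite /sqrt_pairing /=; under eq_bigr do rewrite yE addrAC.
exists (\row_j (Num.sqrt (q j) / Num.sqrt (p j))); split=> [j|x g Xx Gg].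
  by rewrite mxE divr_gt0.
apply: (@le_trans _ _ (\sum_j
    (Num.sqrt (q j) / Num.sqrt (p j) * (x 0 j ^+ 2 - a 0 j ^+ 2) +
     Num.sqrt (p j) / Num.sqrt (q j) * (g 0 j ^+ 2 - b 0 j ^+ 2) +
     2 * (Num.sqrt (p j) * Num.sqrt (q j))))).
  apply: ler_sum => j _; rewrite mxE invf_div.
  have pE : Num.sqrt (p j) ^+ 2 = a 0 j ^+ 2 + tau ^+ 2 by rewrite sqr_sqrtr// ltW.
  have qE : Num.sqrt (q j) ^+ 2 = b 0 j ^+ 2 + tau ^+ 2 by rewrite sqr_sqrtr// ltW.
  have -> : a 0 j ^+ 2 = Num.sqrt (p j) ^+ 2 - tau ^+ 2 by rewrite pE addrK.
  have -> : b 0 j ^+ 2 = Num.sqrt (q j) ^+ 2 - tau ^+ 2 by rewrite qE addrK.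
  rewrite -subr_ge0 [leRHS](_ : _ = tau ^+ 2 *
    (Num.sqrt (q j) / Num.sqrt (p j) + Num.sqrt (p j) / Num.sqrt (q j))); last first.
    by field; rewrite !gt_eqF.
  by rewrite mulr_ge0 ?addr_ge0 ?divr_ge0// ltW.
rewrite !big_split /= -mulr_sumr.
have := Xopt _ Xx; have := Gopt _ Gg; have := hM _ _ Xa Gb.
rewrite /sqrt_pairing -/p -/q; lra.
Qed.

End optimal_scaling.

Section scaling_for_sets.
Context {R : realType} {n : nat}.
Variables (gamma : 'rV[R]_n -> R) (X : set 'rV[R]_n).
Hypotheses (gamma_norm : is_norm gamma)
  (gamma_orthosymmetric : orthosymmetric_norm gamma)
  (gamma_qconvex : quadratically_convex_norm gamma)
  (X_nonempty : X !=set0) (X_qconvex : quadratically_convex X)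
  (X_compact : compact X).
Implicit Types (x g mu v : 'rV[R]_n).

Definition scaling_cost x g mu : R :=
  \sum_j (mu 0 j * x 0 j ^+ 2 + g 0 j ^+ 2 / mu 0 j).

(** Regularizing by [tau] raises the square roots by at most [tau], and the
  coordinates on [X] and on the unit ball are bounded. *)
Lemma near_optimal_scaling : exists2 c : R, 0 <= c &
  forall tau, 0 < tau <= 1 ->
  exists mu, (forall j, 0 < mu 0 j) /\
    forall x g, X x -> gamma g <= 1 ->
      scaling_cost x g mu <= 2 * (dual_radius gamma X + c * tau).
Proof.
have [B XB] := compact_coord_bounded X_compact.
pose b j := (gamma (delta_mx 0 j))^-1.
have b0 j : 0 <= b j by rewrite invr_ge0 norm_nonneg.
have B0 : 0 <= `|B| by [].
exists (\sum_j (`|B| + b j + 1)) => [|tau /andP[tau0 tau1]].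
  by apply: sumr_ge0 => j _; rewrite !addr_ge0.
have ball_nonempty : unit_ball gamma !=set0 by exists 0; rewrite /unit_ball/= norm_zero.
apply: (regularized_scaling_exists X_nonempty ball_nonempty X_compact
  (unit_ball_compact gamma_norm gamma_orthosymmetric) X_qconvex gamma_qconvex tau0).
move=> x g Xx g1.
have root_le (a : R) : Num.sqrt (a ^+ 2 + tau ^+ 2) <= `|a| + tau.
  have at0 : 0 <= `|a| + tau by rewrite addr_ge0// ltW.
  rewrite -(ger0_norm at0) -sqrtr_sqr; apply: ler_wsqrtr.
  rewrite sqrrD real_normK ?num_real// lerD2r lerDl mulrn_wge0// mulr_ge0//.
  exact: ltW.
apply: (@le_trans _ _ (\sum_j (`|x 0 j| * `|g 0 j| + (`|B| + b j + 1) * tau))).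
  apply: ler_sum => j _.
  apply: (le_trans (ler_pM (sqrtr_ge0 _) (sqrtr_ge0 _) (root_le _) (root_le _))).
  have xB : `|x 0 j| <= `|B| := le_trans (XB _ j Xx) (ler_norm B).
  have gb : `|g 0 j| <= b j := ball_coord_le gamma_norm gamma_orthosymmetric j g1.
  rewrite [leRHS]addrC mulrDl mulrDr addrC -!addrA.
  nra.
rewrite big_split /= -mulr_suml lerD2r.
exact: abs_dotp_le_dual_radius.
Qed.

Lemma scaling_cost_continuous x g mu : (forall j, 0 < mu 0 j) ->
  {for mu, continuous (scaling_cost x g)}.
Proof.
move=> mu0.
apply: (@cvg_big R 'I_n +%R 0 xpredT _ 'rV[R]_n (nbhs mu) (index_enum 'I_n)
  (fun j v => v 0 j * x 0 j ^+ 2 + g 0 j ^+ 2 / v 0 j)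
  (fun j => mu 0 j * x 0 j ^+ 2 + g 0 j ^+ 2 / mu 0 j) (nbhs_filter mu)).
  exact: add_continuous.
move=> j _.
apply: (@continuous_comp 'rV[R]_n R R (fun v => v 0 j)
  (fun a => a * x 0 j ^+ 2 + g 0 j ^+ 2 / a) mu).
  exact: coord_continuous.
apply: cvgD; apply: cvgM; [exact: cvg_id|exact: cvg_cst|exact: cvg_cst|].
by apply: cvgV => //; rewrite gt_eqF.
Qed.

Lemma interior_coord_neq0 j : X° !=set0 -> exists2 x, X x & x 0 j != 0.
Proof.
move=> [x /nbhs_ballP[/= e e0 xe]].
have [xj0|] := eqVneq (x 0 j) 0; last first.
  by exists x => //; apply: xe; exact: ballxx.
exists (x + (e / 2) *: delta_mx 0 j).
  apply: xe; split => // i k; rewrite !mxE; apply: (@le_ball _ _ _ (e / 2 + e / 4)).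
    by lra.
  rewrite /ball /= opprD addrA subrr add0r normrN normrM ger0_norm; last by lra.
  by case: (_ && _); rewrite ?normr1 ?normr0; lra.
by rewrite !mxE xj0 !eqxx /= mulr1 add0r gt_eqF// divr_gt0.
Qed.

(** The near-optimal scalings stay in a compact box of positive vectors: an
  upper bound on the cost bounds [mu_j] through a point of [X] whose [j]-th
  coordinate is not zero, and bounds its inverse through a multiple of the
  [j]-th basis vector. *)
Lemma optimal_scaling : X° !=set0 -> exists mu, (forall j, 0 < mu 0 j) /\
  forall x g, X x -> gamma g <= 1 ->
    scaling_cost x g mu <= 2 * dual_radius gamma X.
Proof.
move=> X_body; have [c c0 near_opt] := near_optimal_scaling.
pose D := dual_radius gamma X.
have D0 : 0 <= D.
  have [x0 Xx0] := X_nonempty; rewrite -(dotp0l x0).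
  by apply: dotp_le_dual_radius => //; rewrite norm_zero.
pose tau m : R := m.+1%:R^-1.
have tau01 m : 0 < tau m <= 1 by rewrite invr_gt0 ltr0n invf_le1 ?ltr0n// ler1n.
have /choice[mu muP] : forall m, exists mu, (forall j, 0 < mu 0 j) /\
    forall x g, X x -> gamma g <= 1 -> scaling_cost x g mu <= 2 * (D + c * tau m).
  by move=> m; exact: near_opt.
pose K := 2 * (D + c) + 1.
have K0 : 0 < K by rewrite /K; lra.
have costK m x g : X x -> gamma g <= 1 -> scaling_cost x g (mu m) <= K.
  move=> Xx g1; apply: (le_trans ((muP m).2 _ _ Xx g1)).
  by have /andP[t0 t1] := tau01 m; rewrite /K; nra.
have /choice[y yP] : forall j, exists x, X x /\ x 0 j != 0.
  by move=> j; have [x] := interior_coord_neq0 j X_body; exists x.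
pose b j := (gamma (delta_mx 0 j))^-1.
have b0 j : 0 < b j by rewrite invr_gt0 norm_delta_gt0.
have term_le m x g j : X x -> gamma g <= 1 ->
    mu m 0 j * x 0 j ^+ 2 + g 0 j ^+ 2 / mu m 0 j <= K.
  move=> Xx g1; apply: le_trans (costK m _ _ Xx g1).
  rewrite /scaling_cost (bigD1 j)//= lerDl; apply: sumr_ge0 => i _.
  have mi := ltW ((muP m).1 i).
  by apply: addr_ge0; [apply: mulr_ge0|apply: divr_ge0] => //; exact: sqr_ge0.
pose lo j := b j ^+ 2 / K; pose hi j := K / (y j 0 j ^+ 2).
have lo0 j : 0 < lo j by rewrite divr_gt0// exprn_gt0.
have mu_box m j : `[lo j, hi j]%classic (mu m ord0 j).
  have m0 : 0 < mu m 0 j := (muP m).1 j.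
  have [Xy yj] := yP j; have y2 : 0 < y j 0 j ^+ 2 by rewrite lt_neqAle sqr_ge0 eq_sym sqrf_eq0 yj.
  rewrite /= in_itv /=; apply/andP; split.
    have := term_le m _ _ j Xy (normalized_delta_in_ball gamma_norm j).
    rewrite !mxE !eqxx /= mulr1 -/(b j) => h.
    rewrite ler_pdivrMr// mulrC -ler_pdivrMr//; apply: le_trans h.
    by rewrite lerDr mulr_ge0 ?sqr_ge0// ltW.
  have := @term_le m _ 0 j Xy; rewrite norm_zero// => /(_ ler01).
  by rewrite mxE expr0n mul0r addr0 -ler_pdivlMr.
have := @rV_compact R n (fun j => `[lo j, hi j]%classic) (fun j => @segment_compact R _ _).
move=> /(_ (mu @ \oo) _); case.
  by exists 0%N => // m _ j; exact: mu_box.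
move=> v [v_box v_cluster].
have v0 j : 0 < v 0 j.
  by have := v_box j; rewrite /= in_itv/= => /andP[+ _]; apply: lt_le_trans.
exists v; split=> // x g Xx g1; rewrite -/D leNgt; apply/negP => gap.
pose mid := (scaling_cost x g v + 2 * D) / 2.
have [m0 m0P] : exists m0, forall m, (m0 <= m)%N -> scaling_cost x g (mu m) <= mid.
  pose e := (mid - 2 * D) / (2 * (c + 1)).
  have e0 : 0 < e by rewrite divr_gt0 /mid; lra.
  have [N hN] : exists N : nat, e^-1 < N%:R.
    by exists (Num.bound e^-1); apply: archi_boundP; apply: ltW; rewrite invr_gt0.
  exists N => m Nm; apply: (le_trans ((muP m).2 _ _ Xx g1)).
  have tm : tau m <= e.
    rewrite /tau -[leRHS]invrK lef_pV2 ?posrE ?invr_gt0 ?ltr0n//.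
    by rewrite (le_trans (ltW hN))// ler_nat ltnW.
  have : (c + 1) * tau m <= (c + 1) * e by rewrite ler_pM2l//; lra.
  have -> : (c + 1) * e = (mid - 2 * D) / 2 by rewrite /e; field; lra.
  by have /andP[t0 _] := tau01 m; lra.
have [] := v_cluster [set u | scaling_cost x g u <= mid]
  [set u | mid < scaling_cost x g u].
- by exists m0 => // m /=; exact: m0P.
- have mid_lt : mid < scaling_cost x g v by rewrite /mid; lra.
  have mid_nbhs : nbhs (scaling_cost x g v) [set r | mid < r].
    by apply: open_nbhs_nbhs; split => //; exact: open_gt.
  exact: (@scaling_cost_continuous x g v v0 _ mid_nbhs).
- by move=> u [/= h1 h2]; move: (le_lt_trans h1 h2); rewrite ltxx.
Qed.

End scaling_for_sets.

(** * Regret of the scaled gradient method *)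

Section mirror_descent.
Context {R : realType} {n : nat}.
Implicit Types (x y g lambda mu : 'rV[R]_n).

Lemma mulmx_invmx_diag lambda g j : (forall i, 0 < lambda 0 i) ->
  (g *m invmx (diag_mx lambda)) 0 j = g 0 j / lambda 0 j.
Proof.
move=> l0; pose h := \row_i (g 0 i / lambda 0 i) : 'rV[R]_n.
have gE : g = h *m diag_mx lambda.
  by apply/rowP => i; rewrite mul_mx_diag !mxE divfK// gt_eqF.
rewrite {1}gE mulmxK ?mxE// unitmxE det_diag unitfE.
by apply/prodf_neq0 => i _; rewrite gt_eqF.
Qed.

(** Half the squared [lambda]-weighted distance to [y] is a potential: it drops
  at each step by the linearized regret minus half the weighted squared norm of
  the gradient. *)
Lemma mirror_descent_linear_regret lambda (x g : nat -> 'rV[R]_n) k y :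
  (forall j, 0 < lambda 0 j) -> x 0%N = 0 ->
  (forall i : 'I_k, x i.+1 = x i - g i *m invmx (diag_mx lambda)) ->
  \sum_(i < k) dotp (g i) (x i - y) <=
  2^-1 * (\sum_j lambda 0 j * y 0 j ^+ 2 +
          \sum_(i < k) \sum_j g i 0 j ^+ 2 / lambda 0 j).
Proof.
move=> l0 x0 xS.
pose pot i := \sum_j lambda 0 j * (x i 0 j - y 0 j) ^+ 2.
have pot0 : pot 0%N = \sum_j lambda 0 j * y 0 j ^+ 2.
  by apply: eq_bigr => j _; rewrite x0 mxE sub0r sqrrN.
have step (i : 'I_k) : dotp (g i) (x i - y) =
    2^-1 * (\sum_j g i 0 j ^+ 2 / lambda 0 j) + 2^-1 * (pot i - pot i.+1).
  rewrite /pot -mulrDr -sumrB -big_split mulr_sumr dotpE /=.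
  apply: eq_bigr => j _; have -> : x i.+1 0 j = x i 0 j - g i 0 j / lambda 0 j.
    by rewrite xS mxE [in LHS]mxE mulmx_invmx_diag.
  rewrite !mxE; by field; rewrite gt_eqF.
rewrite (eq_bigr _ (fun i _ => step i)) big_split /= -!mulr_sumr -mulrDr.
rewrite ler_pM2l ?invr_gt0// addrC lerD2r -pot0.
have -> : \sum_(i < k) (pot i - pot i.+1) = pot 0%N - pot k.
  under eq_bigr do rewrite -opprB.
  rewrite sumrN -(big_mkord xpredT (fun i => pot i.+1 - pot i)).
  by rewrite telescope_sumr// opprB.
rewrite gerBl; apply: sumr_ge0 => j _.
by rewrite mulr_ge0 ?sqr_ge0// ltW.
Qed.

(** The factor [sqrt k] in the scaling balances the initial potential, paid once,
  against the squared gradients, paid in each of the [k] rounds. *)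
Lemma mirror_descent_average_regret (X : set 'rV[R]_n) mu (M e : R) k
    (f : 'I_k -> 'rV[R]_n -> R) (x g : nat -> 'rV[R]_n) :
  (0 < k)%N -> (forall j, 0 < mu 0 j) -> x 0%N = 0 ->
  (forall i : 'I_k,
    x i.+1 = x i - g i *m invmx (diag_mx (Num.sqrt k%:R *: mu))) ->
  (forall (i : 'I_k) y, X y -> scaling_cost y (g i) mu <= 2 * M) ->
  (forall (i : 'I_k) y, X y -> f i (x i) + dotp (g i) (y - x i) <= f i y + e) ->
  (average_regret X f (fun i => x i) <= (1 / Num.sqrt k%:R * M + e)%:E)%E.
Proof.
move=> k0 mu0 x0 xS cost fg.
have kR0 : 0 < k%:R :> R by rewrite ltr0n.
have r0 : 0 < Num.sqrt k%:R :> R by rewrite sqrtr_gt0.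
have rr : Num.sqrt k%:R ^+ 2 = k%:R :> R by rewrite sqr_sqrtr// ltW.
set r := Num.sqrt k%:R in r0 rr xS *.
have rmu0 j : 0 < (r *: mu) 0 j by rewrite mxE mulr_gt0.
apply: ge_ereal_sup => _ [y Xy <-]; rewrite lee_fin.
rewrite ler_pdivrMl//.
have lin : \sum_(i < k) (f i (x i) - f i y) <= \sum_(i < k) (dotp (g i) (x i - y) + e).
  by apply: ler_sum => i _; have := fg i y Xy; rewrite -(opprB y) dotpNr; lra.
apply: (le_trans lin); rewrite big_split /= sumr_const card_ord -[e *+ k]mulr_natl.
rewrite mulrDr lerD2r.
apply: (le_trans (mirror_descent_linear_regret y rmu0 x0 xS)).
have -> : \sum_j (r *: mu) 0 j * y 0 j ^+ 2 +
    \sum_(i < k) \sum_j g i 0 j ^+ 2 / (r *: mu) 0 j =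
    r^-1 * \sum_(i < k) scaling_cost y (g i) mu.
  under [X in _ = _ * X]eq_bigr do rewrite /scaling_cost big_split /=.
  rewrite big_split /= sumr_const card_ord -[X in _ = _ * (X + _)]mulr_natl mulrDr.
  congr (_ + _).
    rewrite -rr !mulr_sumr; apply: eq_bigr => j _; rewrite mxE.
    by field; rewrite gt_eqF.
  rewrite mulr_sumr; apply: eq_bigr => i _; rewrite mulr_sumr.
  apply: eq_bigr => j _; rewrite mxE.
  by field; rewrite !gt_eqF.
have costs : \sum_(i < k) scaling_cost y (g i) mu <= k%:R * (2 * M).
  rewrite mulr_natl -[in leRHS](card_ord k) -sumr_const.
  by apply: ler_sum => i _; exact: cost.
rewrite (_ : k%:R * _ = 2^-1 * (r^-1 * (k%:R * (2 * M)))); last first.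
  by field; rewrite gt_eqF.
by rewrite !ler_pM2l ?invr_gt0.
Qed.

End mirror_descent.

(** * Measurable approximate subgradients *)

Section measurability.
Context {R : realType} {n : nat}.
Variables (gamma : 'rV[R]_n -> R) (gamma_norm : is_norm gamma).
Hypothesis gamma_orthosymmetric : orthosymmetric_norm gamma.
Implicit Types (x y g : 'rV[R]_n).

Definition rat_row (q : 'rV[rat]_n) : 'rV[R]_n := map_mx ratr q.

Definition rat_row_nth (m : nat) : 'rV[R]_n :=
  if unpickle m is Some q then rat_row q else 0.

Lemma rat_row_nth_dense x (e : R) : 0 < e ->
  exists m, forall j, `|x 0 j - rat_row_nth m 0 j| <= e.
Proof.
move=> e0.
have /choice[q qP] : forall j, exists q : rat, `|x 0 j - ratr q| <= e.
  move=> j; have /rat_in_itvoo[q] : x 0 j - e < x 0 j + e by lra.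
  by rewrite in_itv/= => /andP[h1 h2]; exists q; rewrite ler_norml; lra.
exists (pickle (\row_j q j)) => j.
by rewrite /rat_row_nth pickleK /rat_row !mxE.
Qed.

Context d (T : measurableType d).

(** A loss that is Lipschitz in the decision is the infimum of countably many
  functions in which the decision enters only through a distance. *)
Lemma measurable_loss_at d' (S : measurableType d') (F : 'rV[R]_n -> S -> R)
    (phi : T -> 'rV[R]_n) (s : T -> S) :
  (forall x y w, F x w - F y w <= weighted_l1 gamma (x - y)) ->
  (forall x, measurable_fun [set: S] (F x)) ->
  measurable_vec phi -> measurable_fun [set: T] s ->
  measurable_fun [set: T] (fun t => F (phi t) (s t)).
Proof.
move=> lip mF mphi ms.
pose w j := (gamma (delta_mx 0 j))^-1.
have w0 j : 0 <= w j by rewrite invr_ge0 norm_nonneg.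
pose h m t := F (rat_row_nth m) (s t) + weighted_l1 gamma (phi t - rat_row_nth m).
have h_lb t m : F (phi t) (s t) <= h m t.
  by have := lip (phi t) (rat_row_nth m) (s t); rewrite /h; lra.
have hE t : F (phi t) (s t) = infs (h ^~ t) 0%N.
  rewrite /infs; apply/eqP; rewrite eq_le; apply/andP; split.
    apply: lb_le_inf; first by exists (h 0%N t), 0%N.
    by move=> _ [m _ <-].
  apply/ler_addgt0Pr => e e0.
  pose e' := e / (2 * (\sum_j w j + 1)).
  have W0 : 0 < \sum_j w j + 1 by rewrite ltr_wpDl// sumr_ge0.
  have e'0 : 0 < e' by rewrite divr_gt0// mulr_gt0.
  have [m hm] := rat_row_nth_dense (phi t) e'0.
  apply: (@le_trans _ _ (h m t)).
    apply: ge_inf; last by exists m.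
    by exists (F (phi t) (s t)) => _ [m' _ <-].
  have l1 : weighted_l1 gamma (phi t - rat_row_nth m) <= e / 2.
    apply: (@le_trans _ _ (\sum_j e' * w j)).
      apply: ler_sum => j _; apply: ler_wpM2r; first exact: w0.
      by rewrite mxE [X in _ + X]mxE; exact: hm.
    have -> : e / 2 = e' * (\sum_j w j + 1) by rewrite /e'; field; rewrite gt_eqF.
    by rewrite -mulr_sumr ler_pM2l// lerDl.
  have := lip (rat_row_nth m) (phi t) (s t).
  by rewrite -[_ - phi t]opprB weighted_l1N /h; lra.
rewrite (_ : (fun t => _) = (fun t => infs (h ^~ t) 0%N)); last first.
  by apply/funext.
apply: measurable_fun_infs => [t _|m].
  by exists (F (phi t) (s t)) => _ [m _ <-].
apply: measurable_funD; first exact: measurableT_comp.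
apply: measurable_sum => j; apply: measurable_funM => //.
apply: measurableT_comp => //.
rewrite (_ : (fun t => _) = (fun t => phi t 0 j - rat_row_nth m 0 j)).
  exact: measurable_funB.
by apply/funext => t; rewrite !mxE.
Qed.

Definition first_index (U : Type) (A : nat -> set U) (u : U) : nat :=
  if pselect (exists m, `[< A m u >]) is left h then ex_minn h else 0%N.

Lemma first_indexP (U : Type) (A : nat -> set U) u :
  (exists m, A m u) -> A (first_index A u) u.
Proof.
move=> [m Amu]; rewrite /first_index; case: pselect => [h|[]]; last first.
  by exists m; apply/asboolP.
by case: ex_minnP => i /asboolP.
Qed.

Lemma measurable_first_index (A : nat -> set T) (B : set nat) :
  (forall m, measurable (A m)) -> measurable (first_index A @^-1` B).
Proof.
move=> mA.
have -> : first_index A @^-1` B =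
    \bigcup_(m in B) ((A m `\` \bigcup_(i in [set i | (i < m)%N]) A i) `|`
                      (if m == 0%N then ~` \bigcup_i A i else set0)).
  apply/seteqP; split => [t Bt|t [m Bm]].
    exists (first_index A t) => //; rewrite /first_index; case: pselect => h.
      case: ex_minnP => m /asboolP Am min_m; left; split=> // -[i /= im Ai].
      by have := min_m i; rewrite leqNgt im => /(_ (asboolT Ai)).
    by right; rewrite eqxx => -[i _ Ai]; apply: h; exists i; apply/asboolP.
  rewrite /preimage/= => h; suff -> : first_index A t = m by [].
  rewrite /first_index; case: h => [[Am nA]|]; last first.
    case: eqVneq => // -> nA; case: pselect => // h.
    by exfalso; case: h => i /asboolP Ai; apply: nA; exists i.
  case: pselect => [h|[]]; last by exists m; apply/asboolP.
  case: ex_minnP => i /asboolP Ai min_i; apply/eqP; rewrite eqn_leq.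
  rewrite min_i ?asboolT//= leqNgt; apply/negP => im.
  by apply: nA; exists i.
apply: bigcup_measurable => m _; apply: measurableU.
  by apply: measurableD => //; apply: bigcup_measurable => i _.
by case: eqP => // _; apply: measurableC; apply: bigcup_measurable => i _.
Qed.

End measurability.

Section approximate_subgradients.
Context {R : realType} {n : nat}.
Variables (gamma : 'rV[R]_n -> R) (gamma_norm : is_norm gamma).
Hypothesis gamma_orthosymmetric : orthosymmetric_norm gamma.
Implicit Types (x y g v : 'rV[R]_n) (f : 'rV[R]_n -> R).

Definition l1 x : R := \sum_j `|x 0 j|.

Lemma l1_ge0 x : 0 <= l1 x.
Proof. exact: sumr_ge0. Qed.

Lemma dotp_le_l1 v x (e : R) : (forall j, `|v 0 j| <= e) -> dotp v x <= e * l1 x.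
Proof.
move=> ve; rewrite dotpE mulr_sumr; apply: ler_sum => j _.
by apply: (le_trans (ler_norm _)); rewrite normrM ler_wpM2r.
Qed.

Lemma l1B x y : l1 (x - y) <= l1 x + l1 y.
Proof.
rewrite -big_split; apply: ler_sum => j _ /=.
by rewrite mxE [X in _ + X]mxE; exact: ler_normB.
Qed.

Lemma l1_le_coords x (e : R) : (forall j, `|x 0 j| <= e) -> l1 x <= n%:R * e.
Proof.
move=> xe; rewrite mulr_natl -[in leRHS](card_ord n) -sumr_const.
by apply: ler_sum => j _; exact: xe.
Qed.

(** Testing only rational points, with a slack, makes this a countable
  conjunction that rational vectors [v] can satisfy. *)
Definition approx_subgradient (e : R) f x v : Prop :=
  gamma v <= 1 + e /\ forall m, f x + dotp v (rat_row_nth m - x) <=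
    f (rat_row_nth m) + e * (1 + l1 (rat_row_nth m)).

Lemma approx_subgradient_exists (e : R) f x : 0 < e -> admissible_loss gamma f ->
  exists m, approx_subgradient e f x (rat_row_nth m).
Proof.
move=> e0 [cf gf]; have [g fg] := subgradient_exists x cf.
have g1 := gf _ _ fg.
pose G := \sum_j gamma (delta_mx 0 j).
have G0 : 0 <= G by apply: sumr_ge0 => j _; exact: norm_nonneg.
have lx0 := l1_ge0 x.
have W0 : 0 < 1 + G + l1 x by rewrite -addrA ltr_pwDl// addr_ge0.
pose r := e / (1 + G + l1 x).
have r0 : 0 < r by rewrite divr_gt0.
have rW : r * (1 + G + l1 x) = e by rewrite divfK// gt_eqF.
have [m hm] := rat_row_nth_dense g r0; exists m.
set v := rat_row_nth m in hm *.
have vg j : `|(v - g) 0 j| <= r by rewrite mxE [X in _ + X]mxE distrC; exact: hm.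
split=> [|m'].
  rewrite -(subrK g v) addrC; apply: (le_trans (is_norm_triangle gamma_norm _ _)).
  rewrite lerD//; apply: (le_trans (norm_le_coords gamma_norm _)).
  apply: (@le_trans _ _ (r * G)); last by nra.
  by rewrite mulr_sumr; apply: ler_sum => j _; rewrite ler_wpM2r ?norm_nonneg.
set y := rat_row_nth m'.
have := dotp_le_l1 (y - x) vg; rewrite dotpDl dotpNl => h1.
have re : r <= e by nra.
have rx : r * l1 x <= e by nra.
have := fg y; have := ler_wpM2l (ltW r0) (l1B y x).
have := ler_wpM2r (l1_ge0 y) re; lra.
Qed.

(** The inequality extends from rational points to all [y] by density, as [f] is
  Lipschitz. *)
Lemma approx_subgradientP (e : R) f x v y : 0 <= e -> admissible_loss gamma f ->
  approx_subgradient e f x v -> f x + dotp v (y - x) <= f y + e * (1 + l1 y).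
Proof.
move=> e0 af [_ hv]; apply/ler_addgt0Pr => a a0.
pose W := \sum_j (gamma (delta_mx 0 j))^-1.
have W0 : 0 <= W by apply: sumr_ge0 => j _; rewrite invr_ge0 norm_nonneg.
have lv0 := l1_ge0 v.
have n0 : 0 <= n%:R :> R by exact: ler0n.
have K0 : 0 < 1 + W + l1 v + e * n%:R.
  by rewrite -!addrA ltr_pwDl// !addr_ge0// mulr_ge0.
pose r := a / (1 + W + l1 v + e * n%:R).
have r0 : 0 < r by rewrite divr_gt0.
have rK : r * (1 + W + l1 v + e * n%:R) = a by rewrite divfK// gt_eqF.
have [m hm] := rat_row_nth_dense y r0.
set z := rat_row_nth m in hm.
have yz j : `|(y - z) 0 j| <= r by rewrite mxE [X in _ + X]mxE; exact: hm.
have := hv m; rewrite -/z => h1.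
have h2 : f z - f y <= r * W.
  apply: le_trans (admissible_lipschitz gamma_norm gamma_orthosymmetric _ _ af) _.
  rewrite -opprB weighted_l1N mulr_sumr; apply: ler_sum => j _.
  by rewrite ler_wpM2r// invr_ge0 norm_nonneg.
have h3 : dotp v y - dotp v z <= r * l1 v.
  by rewrite -dotpBr dotpC; exact: dotp_le_l1.
have h4 : l1 z <= l1 y + n%:R * r.
  rewrite -[z](subKr y); apply: (le_trans (l1B _ _)).
  by rewrite lerD2l; exact: l1_le_coords.
have := ler_wpM2l e0 h4; move: h1; rewrite !dotpBr; nra.
Qed.

Definition select_subgradient (e : R) f x : 'rV[R]_n :=
  rat_row_nth (first_index
    (fun m => [set z : ('rV[R]_n -> R) * 'rV[R]_n |
      approx_subgradient e z.1 z.2 (rat_row_nth m)]) (f, x)).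

Lemma select_subgradientP (e : R) f x : 0 < e -> admissible_loss gamma f ->
  approx_subgradient e f x (select_subgradient e f x).
Proof.
move=> e0 af; apply: (@first_indexP _
  (fun m => [set z : ('rV[R]_n -> R) * 'rV[R]_n |
    approx_subgradient e z.1 z.2 (rat_row_nth m)]) (f, x)).
exact: approx_subgradient_exists.
Qed.

Lemma measurable_select_subgradient d (T : measurableType d) d'
    (S : measurableType d') (F : 'rV[R]_n -> S -> R)
    (phi : T -> 'rV[R]_n) (s : T -> S) (e : R) :
  loss_class gamma F -> measurable_vec phi -> measurable_fun [set: T] s ->
  measurable_vec (fun t => select_subgradient e (F^~ (s t)) (phi t)).
Proof.
move=> /loss_classP[aF mF] mphi ms j.
pose A m := [set t : T | approx_subgradient e (F^~ (s t)) (phi t) (rat_row_nth m)].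
have mA m : measurable (A m).
  have [vb|vb] := pselect (gamma (rat_row_nth m) <= 1 + e); last first.
    by rewrite (_ : A m = set0)//; apply/seteqP; split => // t [].
  have -> : A m = \bigcap_i [set t | F (phi t) (s t) +
      dotp (rat_row_nth m) (rat_row_nth i - phi t) <=
      F (rat_row_nth i) (s t) + e * (1 + l1 (rat_row_nth i))].
    apply/seteqP; split => t; first by case=> _ h i _; exact: h.
    by move=> h; split => // i; exact: h.
  apply: bigcapT_measurable => i.
  rewrite -[X in measurable X]setTI.
  apply: measurable_fun_ler => //.
    apply: measurable_funD; first apply: (measurable_loss_at gamma_norm) => // x y w.
    exact: admissible_lipschitz (aF w).
    under eq_fun do rewrite dotpE.
    apply: measurable_sum => l; apply: measurable_funM => //.
    under eq_fun do rewrite mxE [X in _ + X]mxE.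
    exact: measurable_funB.
  apply: measurable_funD => //; exact: measurableT_comp.
rewrite (_ : (fun t => _) = (fun m => rat_row_nth m 0 j) \o first_index A)//.
move=> _ B mB; rewrite setTI comp_preimage.
exact: measurable_first_index.
Qed.

Definition gradient_strategy (e : R) (lambda : 'rV[R]_n)
    (h : seq ('rV[R]_n -> R)) : 'rV[R]_n :=
  foldl (fun x f => x - select_subgradient e f x *m invmx (diag_mx lambda)) 0 h.

Lemma gradient_strategy_rcons (e : R) lambda h f :
  let x := gradient_strategy e lambda h in
  gradient_strategy e lambda (rcons h f) =
  x - select_subgradient e f x *m invmx (diag_mx lambda).
Proof. by rewrite /gradient_strategy -cats1 foldl_cat. Qed.

Lemma take_observedS k d (S : measurableType d) (F : 'rV[R]_n -> S -> R)
    (s : k.-tuple S) (i : 'I_k) :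
  take i.+1 (observed F s) = rcons (take i (observed F s)) (F^~ (tnth s i)).
Proof.
rewrite (take_nth (fun=> 0)); last by rewrite size_tuple.
by congr rcons; rewrite -tnth_nth tnth_map.
Qed.

Lemma gradient_strategy_rule (e : R) (lambda : 'rV[R]_n) k d (S : measurableType d) :
  (forall j, 0 < lambda 0 j) ->
  strategy_rule k gamma S (gradient_strategy e lambda).
Proof.
move=> l0 F lF i; rewrite /strategy_play.
have : forall m, (m <= k)%N -> measurable_vec (fun s : k.-tuple S =>
    gradient_strategy e lambda (take m (observed F s))).
  elim=> [|m IH] mk j; first by under eq_fun do rewrite take0; exact: measurable_cst.
  pose x (s : k.-tuple S) := gradient_strategy e lambda (take m (observed F s)).
  have mx : measurable_vec x := IH (ltnW mk).
  rewrite (_ : (fun s => _) = (fun s => x s 0 j -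
    select_subgradient e (F^~ (tnth s (Ordinal mk))) (x s) 0 j / lambda 0 j)).
    apply: measurable_funB; first exact: mx.
    apply: measurable_funM => //; apply: measurable_select_subgradient => //.
    exact: measurable_tnth.
  apply/funext => s; rewrite (take_observedS F s (Ordinal mk)) gradient_strategy_rcons.
  by rewrite mxE [X in _ + X]mxE mulmx_invmx_diag.
by apply; exact/ltnW.
Qed.

End approximate_subgradients.

(** * Upper bounds on the regret *)

Section regret_upper_bound.
Context {R : realType} {n : nat}.
Variables (gamma : 'rV[R]_n -> R) (X : set 'rV[R]_n).
Hypotheses (gamma_norm : is_norm gamma)
  (gamma_orthosymmetric : orthosymmetric_norm gamma)
  (gamma_qconvex : quadratically_convex_norm gamma)
  (X_nonempty : X !=set0) (X_qconvex : quadratically_convex X)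
  (X_compact : compact X).

Lemma invr_sqrt_nat_le1 k : (0 < k)%N -> 1 / Num.sqrt k%:R <= 1 :> R.
Proof.
move=> k0; have k1 : 1 <= k%:R :> R by rewrite ler1n.
rewrite ler_pdivrMr ?mul1r ?sqrtr_gt0 ?ltr0n// -[leLHS]sqrtr1.
exact: ler_wsqrtr.
Qed.

Lemma scaling_costZ (x g mu : 'rV[R]_n) (a : R) : (forall j, 0 < mu 0 j) ->
  1 <= a -> scaling_cost x (a *: g) mu <= a ^+ 2 * scaling_cost x g mu.
Proof.
move=> mu0 a1; rewrite /scaling_cost mulr_sumr; apply: ler_sum => j _.
have mx0 : 0 <= mu 0 j * x 0 j ^+ 2 by rewrite mulr_ge0 ?sqr_ge0// ltW.
rewrite mxE exprMn -mulrA mulrDr lerD2r; apply: ler_peMl => //.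
exact: exprn_ege1.
Qed.

(** The selected vectors satisfy [gamma <= 1 + t] instead of [gamma <= 1], which
  multiplies the cost by at most [(1 + t) ^+ 2]. All the errors of order [t], of
  the scaling and of the subgradients, are collected in [c]. *)
Lemma gradient_strategy_regret : exists2 c : R, 0 <= c &
  forall (t : R) k d (S : measurableType d), 0 < t <= 1 -> (0 < k)%N ->
  exists2 xhat, strategy_rule k gamma S xhat &
    (worst_regret k X gamma S xhat <=
      (1 / Num.sqrt k%:R * dual_radius gamma X + c * t)%:E :> \bar R)%E.
Proof.
have [c c0 scalings] := near_optimal_scaling gamma_norm gamma_orthosymmetric
  gamma_qconvex X_nonempty X_qconvex X_compact.
have [B XB] := compact_coord_bounded X_compact.
pose D := dual_radius gamma X.
have D0 : 0 <= D.
  have [x0 Xx0] := X_nonempty; rewrite -(dotp0l x0).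
  by apply: dotp_le_dual_radius => //; rewrite norm_zero.
have nB : 0 <= n%:R * `|B| by rewrite mulr_ge0.
exists (3 * D + 4 * c + 1 + n%:R * `|B|); first by rewrite !addr_ge0// mulr_ge0.
move=> t k d S t01 k0; have /andP[t0 t1] := t01.
have [mu [mu0 cost]] := scalings t t01.
pose lambda := Num.sqrt k%:R *: mu.
have l0 j : 0 < lambda 0 j by rewrite mxE mulr_gt0// sqrtr_gt0 ltr0n.
exists (gradient_strategy gamma t lambda); first exact: gradient_strategy_rule.
apply: ge_ereal_sup => _ [F [s [lF ->]]].
have [aF _] := (loss_classP gamma F).1 lF.
pose x i := gradient_strategy gamma t lambda (take i (observed F s)).
pose g i := if insub i is Some j then
  select_subgradient gamma t (F^~ (tnth s j)) (x i) else 0.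
have gE (i : 'I_k) : g i = select_subgradient gamma t (F^~ (tnth s i)) (x i).
  by rewrite /g valK.
have gP (i : 'I_k) : approx_subgradient gamma t (F^~ (tnth s i)) (x i) (g i).
  by rewrite gE; exact: select_subgradientP.
apply: (@le_trans _ _ (1 / Num.sqrt k%:R * ((1 + t) ^+ 2 * (D + c * t)) +
    t * (1 + n%:R * `|B|))%:E).
  apply: (@mirror_descent_average_regret _ _ _ mu _ _ _ _ x g) => //.
  - by rewrite /x take0.
  - by move=> i; rewrite gE /x take_observedS gradient_strategy_rcons.
  - move=> i y Xy; have t10 : 0 < 1 + t by lra.
    rewrite -[g i](scalerKV (lt0r_neq0 t10)).
    apply: (le_trans (scaling_costZ _ _ mu0 _)); first by lra.
    rewrite mulrCA; apply: ler_wpM2l; first exact: sqr_ge0.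
    apply: cost => //; rewrite (is_norm_homogeneous gamma_norm) normfV.
    by rewrite (ger0_norm (ltW t10)) ler_pdivrMl// mulr1; have [] := gP i.
  - move=> i y Xy.
    apply: (le_trans (approx_subgradientP gamma_norm gamma_orthosymmetric y
      (ltW t0) (aF _) (gP i))).
    rewrite lerD2l ler_pM2l// lerD2l; apply: l1_le_coords => j.
    exact: le_trans (XB _ _ Xy) (ler_norm B).
rewrite lee_fin.
have r1 := invr_sqrt_nat_le1 k0.
have r0 : 0 <= 1 / Num.sqrt k%:R :> R by rewrite divr_ge0.
set r := 1 / Num.sqrt k%:R in r0 r1 *.
have expand : (1 + t) ^+ 2 * (D + c * t) <= D + (3 * D + 4 * c) * t.
  have ct0 : 0 <= c * t by rewrite mulr_ge0// ltW.
  have ct1 : c * t <= c by rewrite ler_piMr.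
  have tt : t ^+ 2 <= t by nra.
  have : (1 + t) ^+ 2 <= 1 + 3 * t by nra.
  move=> /(ler_wpM2r (addr_ge0 D0 ct0)) /le_trans; apply.
  have : t * (c * t) <= t * c by rewrite ler_pM2l.
  nra.
have K0 : 0 <= (3 * D + 4 * c) * t by rewrite mulr_ge0 ?addr_ge0 ?mulr_ge0// ltW.
have := ler_wpM2l r0 expand; have := ler_wpM2r K0 r1; rewrite -/D; nra.
Qed.

Lemma minimax_regret_le k : (0 < k)%N ->
  (minimax_regret k X gamma <= (1 / Num.sqrt k%:R * dual_radius gamma X)%:E)%E.
Proof.
move=> k0; have [c c0 h] := gradient_strategy_regret.
apply: ge_ereal_sup => _ [d [S ->]]; apply/lee_addgt0Pr => e e0.
have ce : 0 < c + e + 1 by lra.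
have t01 : 0 < e / (c + e + 1) <= 1.
  by rewrite divr_gt0//= ler_pdivrMr// mul1r; lra.
have [xhat rule worst] := h _ k d S t01 k0.
apply: (le_trans (ereal_inf_lbound (ex_intro2 _ _ xhat rule erefl))).
apply: (le_trans worst); rewrite -EFinD lee_fin lerD2l.
by rewrite mulrA ler_pdivrMr//; nra.
Qed.

Lemma scaled_gradient_regret k : (0 < k)%N -> X° !=set0 ->
  exists lambda : 'rV[R]_n, (forall j, 0 < lambda 0 j) /\
    forall (losses : 'I_k -> 'rV[R]_n -> R) (x g : nat -> 'rV[R]_n),
      (forall i, admissible_loss gamma (losses i)) ->
      scaled_gradient_run lambda losses x g ->
      (average_regret X losses (fun i => x i)
        <= (1 / Num.sqrt k%:R * dual_radius gamma X)%:E)%E.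
Proof.
move=> k0 X_body; have [mu [mu0 cost]] := optimal_scaling gamma_norm
  gamma_orthosymmetric gamma_qconvex X_nonempty X_qconvex X_compact X_body.
exists (Num.sqrt k%:R *: mu); split=> [j|losses x g al [x0 run]].
  by rewrite mxE mulr_gt0// sqrtr_gt0 ltr0n.
rewrite -[X in (_ <= X%:E)%E]addr0.
apply: (@mirror_descent_average_regret _ _ _ mu _ _ _ _ x g) => //.
- by move=> i; have [_] := run i.
- move=> i y Xy; apply: cost => //; have [gi _] := run i.
  exact: (al i).2 gi.
- by move=> i y Xy; rewrite addr0; have [+ _] := run i; apply.
Qed.

End regret_upper_bound.

(** * Expectations over independent samples *)

Section bounded_expectations.
Context {R : realType} {d : measure_display} {T : measurableType d}.
Variable P : probability T R.

Lemma bounded_integrable (f : T -> R) (B : R) :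
  measurable_fun [set: T] f -> (forall t, `|f t| <= B) ->
  P.-integrable [set: T] (EFin \o f).
Proof.
move=> mf fB; apply: measurable_bounded_integrable => //.
  by rewrite ltey_eq fin_num_measure.
exists B; split; first exact: num_real.
by move=> M BM t _ /=; exact: le_trans (fB t) (ltW BM).
Qed.

Lemma integral_cst_probability (a : R) : (\int[P]_t a%:E = a%:E)%E.
Proof.
rewrite -[LHS]/(\int[P]_t (cst a%:E t))%E integral_cst// -[RHS]mule1.
by congr (_ * _)%E; exact: probability_setT.
Qed.

Lemma integrable_cst_probability (a : R) : P.-integrable [set: T] (EFin \o cst a).
Proof. by apply: (@bounded_integrable _ `|a|). Qed.

End bounded_expectations.

Section iid_samples.
Context {R : realType} {d : measure_display} {S : measurableType d}.
Variable P : probability S R.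

Lemma measurable_cons_sample_slice k (w : S) :
  measurable_fun [set: k.-tuple S] (fun s => cons_sample (w, s)).
Proof.
apply: (@measurable_cons _ _ _ _ (fun=> w) k idfun); first exact: measurable_cst.
exact: measurable_id.
Qed.

Lemma iid_law_integrable_Fubini k (f : k.+1.-tuple S -> R) (B : R) :
  measurable_fun [set: k.+1.-tuple S] f -> (forall s, `|f s| <= B) ->
  P.-integrable [set: S]
    (fun w => \int[iid_law P k]_s (f (cons_sample (w, s)))%:E)%E /\
  (\int[iid_law P k.+1]_s (f s)%:E =
  \int[P]_w \int[iid_law P k]_s (f (cons_sample (w, s)))%:E)%E.
Proof.
move=> mf fB.
have mfc : measurable_fun [set: S * k.-tuple S] (f \o @cons_sample _ S k).
  by apply: measurableT_comp => //; exact: measurable_cons_sample.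
have ifc : (P \x iid_law P k)%E.-integrable [set: S * k.-tuple S]
    (EFin \o (f \o @cons_sample _ S k)).
  apply: (@bounded_integrable _ _ _ (P \x iid_law P k)%E _ B) => // z.
  exact: fB.
split; first exact: (integrable_fubini_F ifc).
rewrite (integral12_prod_meas1 ifc).
by apply: integral_distribution => //; exact/measurable_EFinP.
Qed.

(** Integrating out the last sample first, the loss of the play of that round
  becomes its mean, as the play does not depend on the sample; [c] collects the
  mean losses of the rounds that come before the [k] rounds at hand. Each
  integration is over a single sample with the play held fixed, where [H] is
  integrable. *)
Lemma expected_regret_le (E : Type) (H : E -> S -> R) (B : R) k :
  (forall y, P.-integrable [set: S] (EFin \o H y)) ->
  forall (phi : seq S -> E) (c K : R),
  let h y := \int[P]_w H y w in
  (forall i : 'I_k, measurable_fun [set: k.-tuple S] (fun s => h (phi (take i s)))) ->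
  (forall (i : 'I_k) (s : k.-tuple S), `|h (phi (take i s))| <= B) ->
  (forall s : k.-tuple S,
    c + \sum_(i < k) H (phi (take i s)) (tnth s i) <= K) ->
  (\int[iid_law P k]_s (c + \sum_(i < k) h (phi (take i s)))%:E <= K%:E)%E.
Proof.
move=> iH; elim: k => [|k IH] phi c K h mh hB HK.
  under eq_integral do rewrite big_ord0 addr0.
  rewrite integral_cst_probability lee_fin.
  by have := HK [tuple]; rewrite big_ord0 addr0.
have phi_cons w (s : k.-tuple S) :
    c + \sum_(i < k.+1) h (phi (take i (cons_sample (w, s)))) =
    c + h (phi [::]) + \sum_(i < k) h (phi (w :: take i s)).
  by rewrite big_ord_recl /= addrA.
have mf : measurable_fun [set: k.+1.-tuple S]
    (fun s => c + \sum_(i < k.+1) h (phi (take i s))).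
  by apply: measurable_funD => //; apply: measurable_sum => i; exact: mh.
have [fi ->] := iid_law_integrable_Fubini mf (B := `|c| + \sum_(i < k.+1) B)
  ltac:(by move=> s; apply: (le_trans (ler_normD _ _)); rewrite lerD2l;
    apply: (le_trans (ler_norm_sum _ _ _)); apply: ler_sum => i _; exact: hB).
pose a := K + h (phi [::]); pose K' w := a - H (phi [::]) w.
have iK' : P.-integrable [set: S] (EFin \o K').
  rewrite (_ : EFin \o K' = ((EFin \o cst a) \- (EFin \o H (phi [::])))%E).
    by apply: integrableB => //; exact: integrable_cst_probability.
  by apply/funext => w /=; rewrite -EFinB.
apply: (@le_trans _ _ (\int[P]_w (K' w)%:E)%E).
  apply: le_integral => // w _; under eq_integral do rewrite phi_cons.
  apply: (IH (fun s => phi (w :: s))) => [i|i s|s].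
  - have := measurableT_comp (mh (lift ord0 i)) (measurable_cons_sample_slice (k := k) w).
    exact.
  - exact: (hB (lift ord0 i) (cons_sample (w, s))).
  - have := HK (cons_sample (w, s)); rewrite big_ord_recl tnth0 /=.
    under eq_bigr do rewrite tnthS.
    by rewrite /K' /a; lra.
rewrite (_ : (fun w => _) = ((EFin \o cst a) \- (EFin \o H (phi [::])))%E); last first.
  by apply/funext => w /=; rewrite -EFinB.
rewrite integralB//; last exact: integrable_cst_probability.
rewrite integral_cst_probability.
have -> : (\int[P]_x (EFin \o H (phi [::])) x = (h (phi [::]))%:E)%E.
  by rewrite /h /Rintegral fineK//; apply: integrable_fin_num => //; exact: iH.
by rewrite -EFinB addrK.
Qed.

End iid_samples.

(** * From online strategies to estimators *)

Section mean_losses.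
Context {R : realType} {n : nat}.
Variables (gamma : 'rV[R]_n -> R) (gamma_norm : is_norm gamma).
Hypothesis gamma_orthosymmetric : orthosymmetric_norm gamma.
Context {d : measure_display} {S : measurableType d}.
Variables (P : probability S R) (F : 'rV[R]_n -> S -> R).
Hypotheses (F_loss : loss_class gamma F)
  (F_integrable : forall x, P.-integrable [set: S] (EFin \o F x)).
Implicit Types (x y : 'rV[R]_n).

Let F_admissible w : admissible_loss gamma (F^~ w).
Proof. by have /loss_classP[] := F_loss. Qed.

Lemma mean_loss_lipschitz x y :
  mean_loss P F x - mean_loss P F y <= weighted_l1 gamma (x - y).
Proof.
rewrite /mean_loss -RintegralB//.
have -> : weighted_l1 gamma (x - y) = \int[P]_w (cst (weighted_l1 gamma (x - y)) w).
  by rewrite /Rintegral integral_cst_probability.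
apply: le_Rintegral => //.
- rewrite (_ : EFin \o _ = ((EFin \o F x) \- (EFin \o F y))%E).
    exact: integrableB.
  by apply/funext => w /=; rewrite -EFinB.
- exact: integrable_cst_probability.
- by move=> w _; exact: admissible_lipschitz (F_admissible w).
Qed.

Lemma mean_loss_convex : convex_fun (mean_loss P F).
Proof.
move=> x y t t01; have /andP[t0 t1] := t01.
have iZ a z : P.-integrable [set: S] (EFin \o (fun w => a * F z w)).
  exact: (integrableZl measurableT a (F_integrable z)).
rewrite /mean_loss -!RintegralZl//.
rewrite -RintegralD//; apply: le_Rintegral => //.
  exact: (integrableD measurableT (iZ t x) (iZ (1 - t) y)).
by move=> w _; exact: (F_admissible w).1.
Qed.

(** Jensen's inequality, from a subgradient at the mean. *)
Lemma mean_loss_average k (x : 'I_k -> 'rV[R]_n) : (0 < k)%N ->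
  mean_loss P F (k%:R^-1 *: \sum_i x i) <= k%:R^-1 * \sum_i mean_loss P F (x i).
Proof.
move=> k0; have kR : k%:R != 0 :> R by rewrite pnatr_eq0 -lt0n.
set xbar := _ *: _; have [g hg] := subgradient_exists xbar mean_loss_convex.
rewrite ler_pdivlMl ?ltr0n//.
have -> : k%:R * mean_loss P F xbar =
    \sum_i (mean_loss P F xbar + dotp g (x i - xbar)).
  rewrite big_split /= sumr_const card_ord mulr_natl -[LHS]addr0; congr (_ + _).
  rewrite -(big_morph (dotp g) (dotpDr g) (dotp0r g)) sumrB.
  rewrite sumr_const card_ord -scaler_nat scalerA divff// scale1r.
  by rewrite subrr dotp0r.
by apply: ler_sum => i _; exact: hg.
Qed.

End mean_losses.

Section realizable_sequences.
Context {R : realType} {n : nat}.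
Variables (gamma : 'rV[R]_n -> R) (X : set 'rV[R]_n).
Hypotheses (gamma_norm : is_norm gamma)
  (gamma_orthosymmetric : orthosymmetric_norm gamma).
Variables (X_nonempty : X !=set0) (k : nat).
Context {d : measure_display} {S : measurableType d}.
Variables (w0 : S) (xhat : seq ('rV[R]_n -> R) -> 'rV[R]_n).
Implicit Types (x y : 'rV[R]_n) (psi : nat -> 'rV[R]_n -> R).

Definition sequence_loss psi : 'rV[R]_n -> S * nat -> R := fun x p => psi p.2 x.

Definition sequence_sample : k.-tuple (S * nat) := [tuple (w0, nat_of_ord i) | i < k].

Lemma sequence_loss_class psi : (forall i, admissible_loss gamma (psi i)) ->
  loss_class gamma (sequence_loss psi).
Proof.
move=> apsi; apply/loss_classP; split=> [p|x]; first exact: apsi.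
have mx : measurable_fun [set: nat] (psi^~ x) by [].
exact: (measurableT_comp mx (@measurable_snd _ _ S nat)).
Qed.

Lemma take_observed_sequence psi i : (i <= k)%N ->
  take i (observed (sequence_loss psi) sequence_sample) = mkseq psi i.
Proof.
move=> ik; apply: (@eq_from_nth _ (fun=> 0)).
  by rewrite size_takel ?size_mkseq// size_tuple.
move=> j; rewrite size_takel ?size_tuple// => ji.
have jk : (j < k)%N := leq_trans ji ik.
rewrite nth_take// nth_mkseq//.
rewrite -[j]/(nat_of_ord (Ordinal jk)) -tnth_nth tnth_map tnth_mktuple.
by apply/funext.
Qed.

(** As the second component of a sample carries the round, every sequence of
  admissible losses is presented to the strategy by some loss and samples. *)
Lemma sequence_regret_le psi x : (forall i, admissible_loss gamma (psi i)) -> X x ->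
  ((k%:R^-1 * \sum_(i < k) (psi i (xhat (mkseq psi i)) - psi i x))%:E <=
    worst_regret k X gamma (S * nat)%type xhat)%E.
Proof.
move=> apsi Xx.
apply: (@le_trans _ _ (average_regret X
    (fun i => (sequence_loss psi)^~ (tnth sequence_sample i))
    (strategy_play xhat (sequence_loss psi) sequence_sample))); last first.
  apply: ereal_sup_ubound; exists (sequence_loss psi), sequence_sample.
  by split => //; exact: sequence_loss_class.
apply: ereal_sup_ubound; exists x => //; congr (_ * _)%:E.
apply: eq_bigr => i _; rewrite /strategy_play tnth_mktuple /=.
by rewrite take_observed_sequence// ltnW.
Qed.

(** A strategy of finite worst-case regret plays in a bounded set: any history
  can be followed by an admissible linear loss that is large at a distant play,
  and then by null losses. *)
Lemma strategy_plays_bounded (r : R) :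
  (worst_regret k X gamma (S * nat)%type xhat <= r%:E)%E ->
  exists C : R, forall m psi, (m < k)%N ->
    (forall i, admissible_loss gamma (psi i)) ->
    weighted_l1 gamma (xhat (mkseq psi m)) <= C.
Proof.
move=> xhat_r; have [x Xx] := X_nonempty.
have lx0 : 0 <= weighted_l1 gamma x by exact: weighted_l1_ge0.
suff h m : exists2 C : R, 0 <= C & forall m' psi, (m' < m)%N -> (m' < k)%N ->
    (forall i, admissible_loss gamma (psi i)) ->
    weighted_l1 gamma (xhat (mkseq psi m')) <= C.
  by have [C _ hC] := h k; exists C => m psi mk; exact: hC.
elim: m => [|m [C C0 IH]]; first by exists 0.
have [km|mk] := leqP k m.
  exists C => // m' psi _ m'k; apply: IH => //; exact: leq_trans m'k km.
have kR : 0 < k%:R :> R by rewrite ltr0n (leq_trans _ mk).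
pose C1 := `|k%:R * r| + k%:R * (C + weighted_l1 gamma x) + weighted_l1 gamma x.
have C10 : 0 <= C1 by rewrite !addr_ge0 ?mulr_ge0 ?addr_ge0.
have play_le psi g : (forall i, admissible_loss gamma (psi i)) -> gamma g <= 1 ->
    dotp g (xhat (mkseq psi m)) <= C1.
  move=> apsi g1.
  pose psi' i := if (i < m)%N then psi i else if i == m then dotp g else fun=> 0.
  have psi'E i : (i <= m)%N -> mkseq psi' i = mkseq psi i.
    move=> im; apply/eq_in_map => j; rewrite mem_iota add0n => /andP[_ ji].
    by rewrite /psi' (leq_trans ji im).
  have apsi' i : admissible_loss gamma (psi' i).
    rewrite /psi'; case: ifP => // _; case: ifP => // _.
      exact: admissible_linear.
    exact: admissible_zero.
  have := le_trans (sequence_regret_le apsi' Xx) xhat_r.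
  rewrite lee_fin ler_pdivrMl// (bigD1 (Ordinal mk))//= psi'E//.
  rewrite [psi' m]/psi' ltnn eqxx => h.
  pose a := C + weighted_l1 gamma x.
  have a0 : 0 <= a by rewrite addr_ge0.
  have rest : - (k%:R * a) <=
      \sum_(i < k | i != Ordinal mk) (psi' i (xhat (mkseq psi' i)) - psi' i x).
    apply: (@le_trans _ _ (\sum_(i < k | i != Ordinal mk) - a)).
      rewrite sumrN lerN2 mulr_natl -[in leRHS](card_ord k) -sumr_const.
      by rewrite [leRHS](bigD1 (Ordinal mk))//= lerDr.
    apply: ler_sum => i im; have [im'|mi] := ltnP i m; last first.
      rewrite /psi' ltnNge mi /= -[_ == _]/(i == Ordinal mk) (negbTE im) subrr.
      by rewrite oppr_le0.
    have := admissible_lipschitz gamma_norm gamma_orthosymmetric x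
      (xhat (mkseq psi' i)) (apsi' i).
    have := weighted_l1D gamma_norm x (- xhat (mkseq psi' i)).
    rewrite weighted_l1N; have := IH i psi' im' (ltn_ord i) apsi'.
    by rewrite /a; lra.
  have gx : dotp g x <= weighted_l1 gamma x by exact: dotp_le_weighted_l1.
  have := ler_norm (k%:R * r); rewrite /C1 -/a; lra.
exists (C + \sum_(j < n) C1); first by rewrite addr_ge0// sumr_ge0.
move=> m' psi; rewrite ltnS leq_eqVlt => /predU1P[->|m'm] m'k apsi; last first.
  by apply: (le_trans (IH m' psi m'm m'k apsi)); rewrite lerDl sumr_ge0.
apply: (@le_trans _ _ (\sum_(j < n) C1)); last by rewrite lerDr.
apply: ler_sum => j _; rewrite mulrC.
set b := (gamma (delta_mx 0 j))^-1.
have b0 : 0 <= b by rewrite invr_ge0 norm_nonneg.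
have bj := normalized_delta_in_ball gamma_norm j.
have dotp_delta (c : R) z : dotp (c *: delta_mx 0 j) z = c * z 0 j.
  rewrite dotpZl dotpE (bigD1 j)//= big1 ?addr0 ?mxE ?eqxx ?mul1r// => i ij.
  by rewrite mxE (negbTE ij) andbF mul0r.
have [z0|z0] := leP 0 (xhat (mkseq psi m) 0 j).
  by rewrite ger0_norm// -dotp_delta; apply: play_le.
rewrite ltr0_norm// mulrN -mulNr -dotp_delta; apply: play_le => //.
by rewrite scaleNr norm_opp.
Qed.

End realizable_sequences.

Section online_to_batch.
Context {R : realType} {n : nat}.
Variables (gamma : 'rV[R]_n -> R) (X : set 'rV[R]_n).
Hypotheses (gamma_norm : is_norm gamma)
  (gamma_orthosymmetric : orthosymmetric_norm gamma)
  (X_nonempty : X !=set0) (X_compact : compact X).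
Variables (k : nat) (k_gt0 : (0 < k)%N).

Lemma weighted_l1_average_le (x : 'I_k -> 'rV[R]_n) (C : R) :
  (forall i, weighted_l1 gamma (x i) <= C) ->
  weighted_l1 gamma (k%:R^-1 *: \sum_i x i) <= C.
Proof.
move=> xC; have kR : 0 < k%:R :> R by rewrite ltr0n.
have -> : weighted_l1 gamma (k%:R^-1 *: \sum_i x i) =
    k%:R^-1 * weighted_l1 gamma (\sum_i x i).
  rewrite mulr_sumr; apply: eq_bigr => j _.
  by rewrite mxE normrM ger0_norm ?invr_ge0// mulrA.
rewrite ler_pdivrMl// mulr_natl -[in leRHS](card_ord k) -sumr_const.
apply: (@le_trans _ _ (\sum_i weighted_l1 gamma (x i))); last first.
  by apply: ler_sum => i _; exact: xC.
elim/big_rec2 : _ => [|i u v _ h].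
  by rewrite /weighted_l1 big1// => j _; rewrite mxE normr0 mul0r.
by apply: (le_trans (weighted_l1D gamma_norm _ _)); rewrite lerD2l.
Qed.

Definition average_play (xhat : seq ('rV[R]_n -> R) -> 'rV[R]_n)
    (o : k.-tuple ('rV[R]_n -> R)) : 'rV[R]_n :=
  k%:R^-1 *: \sum_(i < k) xhat (take i o).

Context {d : measure_display} {S : measurableType d}.
Variable xhat : seq ('rV[R]_n -> R) -> 'rV[R]_n.
Hypothesis xhat_rule : strategy_rule k gamma (S * nat)%type xhat.

Lemma measurable_strategy_play (F : 'rV[R]_n -> S -> R) (i : 'I_k) :
  loss_class gamma F ->
  measurable_vec (fun s : k.-tuple S => xhat (take i (observed F s))).
Proof.
move=> lF j; have [aF mF] := (loss_classP gamma F).1 lF.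
pose F' x (p : S * nat) := F x p.1.
have lF' : loss_class gamma F'.
  apply/loss_classP; split=> [p|x]; first exact: aF.
  exact: (measurableT_comp (mF x) (@measurable_fst _ _ S nat)).
pose emb (s : k.-tuple S) := [tuple (tnth s l, 0%N) | l < k].
have memb : measurable_fun [set: k.-tuple S] emb.
  apply/measurable_fun_tnthP => l.
  rewrite (_ : _ \o emb = (fun s => (tnth s l, 0%N))).
    by apply: measurable_fun_pair => //; exact: measurable_tnth.
  by apply/funext => s /=; rewrite tnth_mktuple.
have -> : (fun s => xhat (take i (observed F s)) 0 j) =
    (fun s => strategy_play xhat F' s i 0 j) \o emb.
  apply/funext => s /=; rewrite /strategy_play.
  suff -> : observed F' (emb s) = observed F s by [].
  by apply: eq_from_tnth => l; rewrite [LHS]tnth_map [RHS]tnth_map tnth_mktuple.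
exact: measurableT_comp (xhat_rule lF' i j) memb.
Qed.

Lemma average_play_rule : estimator_rule gamma S (average_play xhat).
Proof.
move=> F lF j.
rewrite (_ : (fun s => _) = (fun s : k.-tuple S =>
    k%:R^-1 * \sum_(i < k) xhat (take i (observed F s)) 0 j)).
  apply: measurable_funM => //; apply: measurable_sum => i.
  exact: measurable_strategy_play.
by apply/funext => s; rewrite mxE summxE.
Qed.

(** Against a comparator [x] whose mean loss is within [e] of the infimum over
  [X], the regret bound of the strategy integrates to the risk bound up to [e]. *)
Lemma excess_risk_average_play (F : 'rV[R]_n -> S -> R) (P : probability S R) (r : R) :
  loss_class gamma F -> (forall x, P.-integrable [set: S] (EFin \o F x)) ->
  (worst_regret k X gamma (S * nat)%type xhat <= r%:E)%E ->
  (excess_risk X (average_play xhat) F P <= r%:E)%E.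
Proof.
move=> lF iF xhat_r; have [aF mF] := (loss_classP gamma F).1 lF.
have [w0 _] : [set: S] !=set0.
  apply/set0P/eqP => S0; have := probability_setT P.
  by rewrite S0 measure0 => /eqP; rewrite eqe eq_sym oner_eq0.
pose f := mean_loss P F.
have f_lip : forall x y, f x - f y <= weighted_l1 gamma (x - y).
  by move=> x y; exact: mean_loss_lipschitz.
have lip_abs x y : `|f x - f y| <= weighted_l1 gamma x + weighted_l1 gamma y.
  have := f_lip x y; have := f_lip y x; rewrite -[y - x]opprB weighted_l1N.
  have := weighted_l1D gamma_norm x (- y); rewrite weighted_l1N ler_norml; lra.
have [C hC] := strategy_plays_bounded gamma_norm gamma_orthosymmetric X_nonempty w0 xhat_r.
have mkseqE (s : k.-tuple S) i : (i < k)%N ->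
    mkseq (fun j => F^~ (nth w0 s j)) i = take i (observed F s).
  move=> ik; rewrite /observed /= -map_take -(@map_nth_iota0 _ w0).
    by rewrite -map_comp.
  by rewrite size_tuple ltnW.
have play_le (s : k.-tuple S) (i : 'I_k) :
    weighted_l1 gamma (xhat (take i (observed F s))) <= C.
  by rewrite -mkseqE//; apply: hC.
have mf (phi : k.-tuple S -> 'rV[R]_n) : measurable_vec phi ->
    measurable_fun [set: k.-tuple S] (f \o phi).
  move=> mphi; apply: (measurable_loss_at gamma_norm
    (S := k.-tuple S) (F := fun x _ => f x) (s := idfun)) => //.
  exact: measurable_id.
have kV1 : k%:R^-1 <= 1 :> R by rewrite invf_le1 ?ler1n ?ltr0n.
have kV0 : 0 <= k%:R^-1 :> R by rewrite invr_ge0.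
have [B XB] := weighted_l1_bounded gamma_norm X_compact.
set I := ereal_inf [set (mean_loss P F x)%:E | x in X].
have I_fin : I \is a fin_num.
  rewrite fin_numE; apply/andP; split.
    apply/eqP => IE; have : ((f 0 - B)%:E <= I)%E.
      apply: le_ereal_inf_tmp => _ [x Xx <-]; rewrite lee_fin.
      have := f_lip 0 x; rewrite sub0r weighted_l1N; have := XB _ Xx.
      by rewrite /f; lra.
    by rewrite IE.
  have [x Xx] := X_nonempty; rewrite -ltey; apply: (@le_lt_trans _ _ (f x)%:E).
    by apply: ereal_inf_lbound; exists x.
  exact: ltry.
pose iota := fine I; have IE : I = iota%:E by rewrite fineK.
pose Z s := f (average_play xhat (observed F s)) - iota.
have iZ : (iid_law P k).-integrable [set: k.-tuple S] (EFin \o Z).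
  apply: (@bounded_integrable _ _ _ _ _ (C + weighted_l1 gamma 0 + `|f 0 - iota|)).
    apply: measurable_funB => //.
    by apply: (mf (fun s => average_play xhat (observed F s))); exact: average_play_rule.
  move=> s; rewrite /Z -[f _](subrK (f 0)) -addrA; apply: (le_trans (ler_normD _ _)).
  rewrite lerD2r; apply: (le_trans (lip_abs _ _)); rewrite lerD2r.
  exact: weighted_l1_average_le.
have Z_le : (\int[iid_law P k]_s (Z s)%:E <= r%:E)%E.
  apply/lee_addgt0Pr => e e0.
  have [_ [x Xx <-]] := lb_ereal_inf_adherent e0 I_fin.
  rewrite -/I IE -EFinD lte_fin -/(f x) => fx_lt.
  pose H y w := k%:R^-1 * (F y w - F x w).
  have iB y : P.-integrable [set: S] (EFin \o (fun w => F y w - F x w)).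
    exact: (integrableB measurableT (iF y) (iF x)).
  have iH y : P.-integrable [set: S] (EFin \o H y).
    exact: (integrableZl measurableT k%:R^-1 (iB y)).
  have hE y : \int[P]_w H y w = k%:R^-1 * (f y - f x).
    by rewrite /H RintegralZl// RintegralB.
  pose phi (h : seq S) := xhat (map (fun w => F^~ w) h).
  have phiE (s : k.-tuple S) i : phi (take i s) = xhat (take i (observed F s)).
    by rewrite /phi map_take.
  have h_bound (i : 'I_k) (s : k.-tuple S) :
      `|\int[P]_w H (phi (take i s)) w| <= C + weighted_l1 gamma x.
    rewrite hE normrM (ger0_norm kV0).
    apply: (@le_trans _ _ (1 * `|f (phi (take i s)) - f x|)); first exact: ler_wpM2r.
    by rewrite mul1r; apply: (le_trans (lip_abs _ _)); rewrite lerD2r phiE.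
  have h_meas (i : 'I_k) : measurable_fun [set: k.-tuple S]
      (fun s => \int[P]_w H (phi (take i s)) w).
    rewrite (_ : (fun s => _) = (fun s : k.-tuple S =>
        k%:R^-1 * (f (xhat (take i (observed F s))) - f x))).
      apply: measurable_funM => //; apply: measurable_funB => //.
      by apply: (mf (fun s => xhat (take i (observed F s)))); exact: measurable_strategy_play.
    by apply/funext => s; rewrite hE phiE.
  have regret (s : k.-tuple S) :
      e + \sum_(i < k) H (phi (take i s)) (tnth s i) <= r + e.
    rewrite addrC lerD2r -mulr_sumr.
    have := le_trans (sequence_regret_le k w0 xhat (psi := fun j => F^~ (nth w0 s j))
      (fun j => aF _) Xx) xhat_r.
    rewrite lee_fin; apply: le_trans; rewrite ler_wpM2l//.
    by apply: ler_sum => i _; rewrite mkseqE// phiE (tnth_nth w0).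
  have := expected_regret_le iH h_meas h_bound regret; rewrite EFinD; apply: le_trans.
  apply: le_integral => //.
    apply: (@bounded_integrable _ _ _ _ _ (`|e| + \sum_(i < k) (C + weighted_l1 gamma x))).
      by apply: measurable_funD => //; apply: measurable_sum.
    move=> s; apply: (le_trans (ler_normD _ _)); rewrite lerD2l.
    by apply: (le_trans (ler_norm_sum _ _ _)); apply: ler_sum => i _; exact: h_bound.
  move=> s _; rewrite lee_fin.
  have := mean_loss_average lF iF
    (fun i : 'I_k => xhat (take i (observed F s))) k_gt0.
  under [X in _ -> _ <= _ + X]eq_bigr do rewrite hE phiE.
  rewrite -mulr_sumr sumrB sumr_const card_ord mulrBr -[f x *+ k]mulr_natl.
  rewrite mulKf ?pnatr_eq0 -?lt0n// /Z -/f -/(average_play xhat (observed F s)).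
  by lra.
rewrite /excess_risk -/I IE /expected_value.
case: ifPn => [/eqP Zpos|_]; last exact: Z_le.
have := integrable_fin_num measurableT (integrable_funepos measurableT iZ).
by rewrite [X in X \is a fin_num](Zpos : (\int[iid_law P k]_w (EFin \o Z)^\+ w = +oo)%E).
Qed.

End online_to_batch.

Lemma minimax_stochastic_le_regret {R : realType} {n : nat}
    (gamma : 'rV[R]_n -> R) (X : set 'rV[R]_n) (k : nat) :
  is_norm gamma -> orthosymmetric_norm gamma -> X !=set0 -> compact X ->
  (0 < k)%N ->
  (minimax_stochastic_risk k X gamma <= minimax_regret k X gamma)%E.
Proof.
move=> gamma_norm gamma_ortho X0 cX k0.
apply: ge_ereal_sup => _ [d [S ->]].
apply: le_ereal_sup_tmp; exists (ereal_inf [set worst_regret k X gamma (S * nat)%type xhat |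
  xhat in strategy_rule k gamma (S * nat)%type]).
  by exists _, (S * nat)%type.
apply: le_ereal_inf_tmp => _ [xhat rule <-].
apply: (@le_trans _ _ (worst_excess_risk X gamma S (average_play (k := k) xhat))).
  apply: ereal_inf_lbound; exists (average_play (k := k) xhat) => //.
  exact: average_play_rule.
apply: ge_ereal_sup => _ [F [P [lF iF ->]]].
case W : (worst_regret k X gamma (S * nat)%type xhat) => [r| |].
- apply: (excess_risk_average_play gamma_norm gamma_ortho X0 cX k0 rule lF iF).
  by rewrite W.
- exact: leey.
- have risk_le r : (excess_risk X (average_play (k := k) xhat) F P <= r%:E)%E.
    apply: (excess_risk_average_play gamma_norm gamma_ortho X0 cX k0 rule lF iF).
    by rewrite W leNye.
  case: (excess_risk X _ F P) risk_le => [a| |] // h.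
  + by have := h (a - 1)%R; rewrite lee_fin lerBrDr gerDl ler10.
  + by have := h 0%R.
Qed.

(** * Lower bound from two biased coins *)

Section absolute_losses.
Context {R : realType} {n : nat}.
Variables (gamma : 'rV[R]_n -> R) (gamma_norm : is_norm gamma).
Implicit Types (g x y v : 'rV[R]_n).

(** A linear form bounded by [|g . v|] vanishes where [g] does, hence is a
  multiple of [g]. *)
Lemma dotp_le_abs_dotp g h : (forall v, dotp h v <= `|dotp g v|) ->
  exists2 t : R, `|t| <= 1 & h = t *: g.
Proof.
move=> hg; have [g0|g0] := eqVneq (dotp g g) 0.
  exists 0; first by rewrite normr0.
  rewrite scale0r; apply: dotp_eq0; apply: (le_trans (hg h)).
  by rewrite (dotp_eq0 (x := g)) ?g0// dotp0l normr0.
have gg : 0 < dotp g g by rewrite lt_neqAle eq_sym g0 dotp_ge0.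
pose t := dotp h g / dotp g g; exists t.
  rewrite normrM normfV (gtr0_norm gg) ler_pdivrMr// mul1r ler_norml.
  have := hg g; have := hg (- g); rewrite !dotpNr normrN gtr0_norm//; lra.
apply/eqP; rewrite -subr_eq0; apply/eqP; set v := h - t *: g.
have gv : dotp g v = 0 by rewrite dotpBr dotpZr /t (dotpC h) divfK// subrr.
apply: dotp_eq0; rewrite {1}/v dotpDl dotpNl dotpZl gv mulr0 subr0.
by apply: (le_trans (hg v)); rewrite gv normr0.
Qed.

Lemma admissible_abs_linear g (b : R) : gamma g <= 1 ->
  admissible_loss gamma (fun x => `|dotp g x - b|).
Proof.
move=> g1; split=> [x y t /andP[t0 t1]|x h hx].
  have -> : dotp g (t *: x + (1 - t) *: y) - b =
      t * (dotp g x - b) + (1 - t) * (dotp g y - b).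
    by rewrite dotpDr !dotpZr; ring.
  apply: (le_trans (ler_normD _ _)); rewrite !normrM (ger0_norm t0).
  by rewrite [`|1 - t|]ger0_norm// subr_ge0.
have [t t1 ->] : exists2 t : R, `|t| <= 1 & h = t *: g.
  apply: dotp_le_abs_dotp => v; have := hx (x + v).
  have -> : x + v - x = v by rewrite addrC addKr.
  have -> : dotp g (x + v) - b = dotp g v + (dotp g x - b) by rewrite dotpDr; ring.
  have := ler_normD (dotp g v) (dotp g x - b); lra.
by rewrite (is_norm_homogeneous gamma_norm) mulr_ile1// norm_nonneg.
Qed.

End absolute_losses.

Section coin_flips.
Context {R : realType}.

Lemma measurable_tuple_bool k (A : set (k.-tuple bool)) : measurable A.
Proof.
apply: countable_measurable; last exact: countableP.
move=> s; have -> : [set s] = \bigcap_(i in [set: 'I_k])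
    ((@tnth _ bool)^~ i @^-1` [set tnth s i]).
  apply/seteqP; split => [t -> //|t h].
  by apply: eq_from_tnth => i; exact: (h i).
apply: fin_bigcap_measurable => // i _.
by rewrite -[X in measurable X]setTI; exact: measurable_tnth.
Qed.

Lemma measurable_fun_tuple_bool k d (U : measurableType d) (f : k.-tuple bool -> U) :
  measurable_fun [set: k.-tuple bool] f.
Proof. by move=> _ B _; exact: measurable_tuple_bool. Qed.

Fixpoint coin_mean (p : R) k : (k.-tuple bool -> R) -> R :=
  match k with
  | 0 => fun f => f [tuple]
  | k'.+1 => fun f => p * coin_mean p (fun s => f (cons_sample (true, s))) +
                     (1 - p) * coin_mean p (fun s => f (cons_sample (false, s)))
  end.

Lemma coin_mean_ge0 (p : R) k (f : k.-tuple bool -> R) : 0 <= p <= 1 ->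
  (forall s, 0 <= f s) -> 0 <= coin_mean p f.
Proof.
move=> /andP[p0 p1]; elim: k f => [|k IH] f f0 /=; first exact: f0.
by rewrite addr_ge0// mulr_ge0 ?subr_ge0//; apply: IH.
Qed.

Lemma coin_mean_affine (p a b : R) k (f : k.-tuple bool -> R) :
  coin_mean p (fun s => a + b * f s) = a + b * coin_mean p f.
Proof. by elim: k f => [|k IH] f //=; rewrite !IH; ring. Qed.

Lemma integral_coin_flips (p : R) k (f : k.-tuple bool -> R) : 0 <= p <= 1 ->
  (forall s, 0 <= f s) ->
  (\int[iid_law (bernoulli_prob p) k]_s (f s)%:E = (coin_mean p f)%:E)%E.
Proof.
move=> p01; elim: k f => [|k IH] f f0.
  by rewrite [LHS]integral_dirac ?diracT ?mul1e//; exact: measurable_fun_tuple_bool.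
have f_bound s : `|f s| <= \sum_t f t.
  by rewrite ger0_norm// (bigD1 s)//= lerDl sumr_ge0.
have [_ ->] := iid_law_integrable_Fubini (bernoulli_prob p)
  (@measurable_fun_tuple_bool _ _ _ f) f_bound.
under eq_integral do rewrite IH//.
rewrite integral_bernoulli_prob//.
by move=> w; rewrite lee_fin; apply: coin_mean_ge0.
Qed.

(** The second moment of the difference of the likelihood ratios of two coins of
  opposite biases with respect to fair coins; it tensorizes because the weights
  [a] and [b] absorb the likelihoods of the first flip. *)
Lemma coin_mean_difference (delta A a b : R) k (f : k.-tuple bool -> R) :
  (forall s, `|f s| <= A) ->
  (a * coin_mean ((1 + delta) / 2) f - b * coin_mean ((1 - delta) / 2) f) ^+ 2 <=
  A ^+ 2 * ((a ^+ 2 + b ^+ 2) * (1 + delta ^+ 2) ^+ k -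
            2 * a * b * (1 - delta ^+ 2) ^+ k).
Proof.
elim: k a b f => [|k IH] a b f fA /=.
  have -> : (a * f [tuple] - b * f [tuple]) ^+ 2 = `|f [tuple]| ^+ 2 * (a - b) ^+ 2.
    by rewrite real_normK ?num_real//; ring.
  rewrite !expr0 !mulr1 (_ : a ^+ 2 + b ^+ 2 - _ = (a - b) ^+ 2); last by ring.
  by apply: ler_wpM2r; [exact: sqr_ge0|rewrite lerXn2r ?nnegrE// (le_trans _ (fA [tuple]))].
set p := (1 + delta) / 2; set q := (1 - delta) / 2.
have -> : 1 - p = q by rewrite /p /q; field.
have -> : 1 - q = p by rewrite /p /q; field.
have := IH (a * p) (b * q) (fun s => f (cons_sample (true, s))) (fun s => fA _).
have := IH (a * q) (b * p) (fun s => f (cons_sample (false, s))) (fun s => fA _).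
rewrite -/p -/q; pose Mf := coin_mean p (fun s => f (cons_sample (false, s))).
pose Nf := coin_mean q (fun s => f (cons_sample (false, s))).
pose Mt := coin_mean p (fun s => f (cons_sample (true, s))).
pose Nt := coin_mean q (fun s => f (cons_sample (true, s))).
rewrite -/Mf -/Nf -/Mt -/Nt.
set u := (1 + delta ^+ 2) ^+ k; set v := (1 - delta ^+ 2) ^+ k => h1 h2.
rewrite !(exprS _ k) -/u -/v.
have -> : A ^+ 2 * ((a ^+ 2 + b ^+ 2) * ((1 + delta ^+ 2) * u) -
    2 * a * b * ((1 - delta ^+ 2) * v)) =
  2 * (A ^+ 2 * (((a * q) ^+ 2 + (b * p) ^+ 2) * u - 2 * (a * q) * (b * p) * v)) +
  2 * (A ^+ 2 * (((a * p) ^+ 2 + (b * q) ^+ 2) * u - 2 * (a * p) * (b * q) * v)).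
  by rewrite /p /q; field.
apply: le_trans (lerD (ler_wpM2l (ler0n _ 2) h1) (ler_wpM2l (ler0n _ 2) h2)).
set T1 := a * q * _ - _; set T2 := a * p * _ - _.
have -> : a * (p * Mt + q * Mf) - b * (q * Nt + p * Nf) = T1 + T2.
  by rewrite /T1 /T2; ring.
have := sqr_ge0 (T1 - T2); lra.
Qed.

Lemma expr_bounds (u : R) k : 0 <= u -> k%:R * u = 4^-1 ->
  (1 + u) ^+ k <= 4 / 3 /\ 3 / 4 <= (1 - u) ^+ k.
Proof.
move=> u0 ku.
have bern m : (m <= k)%N -> 1 - m%:R * u <= (1 - u) ^+ m /\ (1 + u) ^+ m * (1 - m%:R * u) <= 1.
  elim: m => [|m IH] mk; first by rewrite !expr0 mul0r subr0 mul1r.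
  have [IH1 IH2] := IH (ltnW mk).
  have mR : (m%:R + 1) * u <= 4^-1.
    by rewrite -ku ler_wpM2r// natr1 ler_nat.
  have m0 : 0 <= m%:R * u by rewrite mulr_ge0.
  rewrite -natr1 !(exprS _ m); split; first by nra.
  have x0 : 0 <= (1 + u) ^+ m by rewrite exprn_ge0// addr_ge0.
  have : (1 + u) * (1 - (m%:R + 1) * u) <= 1 - m%:R * u by nra.
  move=> /(ler_wpM2l x0); lra.
have [h1 h2] := bern k (leqnn k); rewrite ku in h1 h2; split; lra.
Qed.

End coin_flips.

Section two_point_problem.
Context {R : realType} {n : nat}.
Variables (gamma : 'rV[R]_n -> R) (X : set 'rV[R]_n).
Hypotheses (gamma_norm : is_norm gamma).
Variables (g a : 'rV[R]_n) (g1 : gamma g <= 1).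
Variables (Xa : X a) (XNa : X (- a)).
Let A := dotp g a.
Hypothesis A_ge0 : 0 <= A.
Variable (k : nat).
Implicit Types (x : 'rV[R]_n) (v : bool).

Definition pm (v : bool) : R := if v then 1 else -1.

Definition coin_loss : 'rV[R]_n -> bool -> R :=
  fun x w => `|dotp g x - pm w * A|.

Lemma coin_loss_class : loss_class gamma coin_loss.
Proof. by apply/loss_classP; split=> // w; exact: admissible_abs_linear. Qed.

Variable delta : R.
Hypothesis delta01 : 0 <= delta <= 1.

Definition coin_bias v : R := (1 + pm v * delta) / 2.

Lemma coin_bias01 v : 0 <= coin_bias v <= 1.
Proof. by have /andP[d0 d1] := delta01; rewrite /coin_bias /pm; case: v; lra. Qed.

Lemma coin_loss_integrable v x :
  (bernoulli_prob (coin_bias v)).-integrable [set: bool] (EFin \o coin_loss x).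
Proof.
apply: (@bounded_integrable _ _ _ _ _ (coin_loss x true + coin_loss x false)) => // w.
by rewrite normr_id; case: w; rewrite ?lerDl ?lerDr /coin_loss.
Qed.

Lemma mean_coin_loss v x : mean_loss (bernoulli_prob (coin_bias v)) coin_loss x =
  coin_bias v * `|dotp g x - A| + (1 - coin_bias v) * `|dotp g x + A|.
Proof.
rewrite /mean_loss /Rintegral integral_bernoulli_prob ?coin_bias01//; last first.
  by move=> w; rewrite lee_fin /coin_loss.
by rewrite -!EFinM -EFinD /= /coin_loss /pm mul1r mulN1r opprK.
Qed.

(** When [dotp g x] is not between [- A] and [A], both mean losses exceed those at
  the nearer of these two values, so an estimator is charged for its clipped
  value only. *)
Definition clip x : R := Num.max (- A) (Num.min (dotp g x) A).

Lemma clip_le x : `|clip x| <= A.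
Proof.
by rewrite /clip ler_norml le_max lexx /= ge_max ge_min lexx orbT andbT ge0_cp.
Qed.

Lemma mean_coin_loss_ge v x :
  A - pm v * delta * clip x <= mean_loss (bernoulli_prob (coin_bias v)) coin_loss x.
Proof.
have /andP[d0 d1] := delta01; rewrite mean_coin_loss /clip /coin_bias.
have A0 : 0 <= A by exact: A_ge0.
have NA : - A <= A by lra.
set u := dotp g x.
have [uA|uA] := leP u A; have [Au|Au] := leP (- A) u.
- rewrite ler0_norm ?subr_le0// ger0_norm -?lerBlDr ?sub0r//.
  by rewrite /pm; case: v; lra.
- rewrite ler0_norm ?subr_le0// ler0_norm; last by lra.
  by rewrite /pm; case: v; nra.
- rewrite (max_r NA).
  rewrite ger0_norm; last by lra.
  rewrite ger0_norm; last by lra.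
  by rewrite /pm; case: v; nra.
- by lra.
Qed.

Lemma best_coin_loss_le v :
  (ereal_inf [set (mean_loss (bernoulli_prob (coin_bias v)) coin_loss x)%:E | x in X]
    <= ((1 - delta) * A)%:E)%E.
Proof.
have /andP[d0 d1] := delta01.
apply: (@le_trans _ _
  (mean_loss (bernoulli_prob (coin_bias v)) coin_loss (pm v *: a))%:E).
  apply: ereal_inf_lbound; exists (pm v *: a) => //.
  by case: v; rewrite /pm ?scale1r ?scaleN1r.
rewrite lee_fin mean_coin_loss dotpZr -/A /coin_bias /pm; case: v.
  have A0 : 0 <= A by exact: A_ge0.
  by rewrite !mul1r subrr normr0 ger0_norm; lra.
have A0 : 0 <= A by exact: A_ge0.
by rewrite !mulN1r addNr normr0 ler0_norm; lra.
Qed.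

Lemma coin_excess_risk_ge v (xhat : k.-tuple ('rV[R]_n -> R) -> 'rV[R]_n) :
  ((delta * A - pm v * delta *
     coin_mean (coin_bias v) (fun s => clip (xhat (observed coin_loss s))))%:E <=
  excess_risk X xhat coin_loss (bernoulli_prob (coin_bias v)))%E.
Proof.
have /andP[d0 d1] := delta01.
rewrite /excess_risk /expected_value; case: ifPn => _; first exact: leey.
pose G s := delta * A + - (pm v * delta) * clip (xhat (observed coin_loss s)).
have G0 s : 0 <= G s.
  have := clip_le (xhat (observed coin_loss s)); rewrite ler_norml /G /pm.
  by move=> /andP[h1 h2]; case: (v); nra.
have <- : (\int[iid_law (bernoulli_prob (coin_bias v)) k]_s (G s)%:E =
    (delta * A - pm v * delta *
     coin_mean (coin_bias v) (fun s => clip (xhat (observed coin_loss s))))%:E)%E.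
  rewrite integral_coin_flips ?coin_bias01// /G coin_mean_affine.
  by rewrite mulNr.
have G_le s : ((G s)%:E <=
    (mean_loss (bernoulli_prob (coin_bias v)) coin_loss (xhat (observed coin_loss s)))%:E -
    ereal_inf [set (mean_loss (bernoulli_prob (coin_bias v)) coin_loss x)%:E | x in X])%E.
  apply: le_trans (leeB (lexx _) (best_coin_loss_le v)).
  rewrite -EFinB lee_fin; have := mean_coin_loss_ge v (xhat (observed coin_loss s)).
  by rewrite /G; lra.
apply: ge0_le_integral => //.
- by move=> s _; rewrite lee_fin.
- exact: measurable_fun_tuple_bool.
- exact: measurable_fun_tuple_bool.
Qed.

End two_point_problem.

Lemma ln3_ge (R : realType) : 2 / 3 <= ln 3 :> R.
Proof.
have h : 0 < 3^-1 :> R by rewrite invr_gt0.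
have := @le_ln1Dx R (- (2 / 3)) ltac:(lra).
have -> : 1 + - (2 / 3) = 3^-1 :> R by field.
by rewrite lnV ?posrE//; lra.
Qed.

Lemma stochastic_risk_ge_dotp {R : realType} {n : nat}
    (gamma : 'rV[R]_n -> R) (X : set 'rV[R]_n) (k : nat) (g a : 'rV[R]_n) :
  is_norm gamma -> (0 < k)%N -> gamma g <= 1 -> X a -> X (- a) -> 0 <= dotp g a ->
  ((1 / (8 * Num.sqrt (ln 3)) * (1 / Num.sqrt k%:R) * dotp g a)%:E <=
    minimax_stochastic_risk k X gamma)%E.
Proof.
move=> gamma_norm k0 g1 Xa XNa A0; set A := dotp g a in A0 *.
have kR : 1 <= k%:R :> R by rewrite ler1n.
have r1 : 1 <= Num.sqrt k%:R :> R by rewrite -[leLHS]sqrtr1; apply: ler_wsqrtr.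
have rr : Num.sqrt k%:R ^+ 2 = k%:R :> R by rewrite sqr_sqrtr.
set r := Num.sqrt k%:R in r1 rr *.
have r0 : 0 < r by lra.
pose delta := 1 / (2 * r).
have delta0 : 0 < delta by rewrite divr_gt0// mulr_gt0.
have delta01 : 0 <= delta <= 1.
  by rewrite ltW//= ler_pdivrMr ?mulr_gt0//; lra.
have kd : k%:R * delta ^+ 2 = 4^-1.
  by rewrite -rr /delta; field; rewrite gt_eqF.
have [u1 u2] := expr_bounds (sqr_ge0 delta) kd.
have const_le : 1 / (8 * Num.sqrt (ln 3)) * (1 / r) * A <= 11 / 24 * (delta * A).
  have l3 : 3 / 5 <= Num.sqrt (ln 3) :> R.
    rewrite -[leLHS]ger0_norm// -sqrtr_sqr; apply: ler_wsqrtr.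
    by have := ln3_ge R; rewrite expr2; lra.
  have l0 : 0 < Num.sqrt (ln 3) :> R by lra.
  have -> : 11 / 24 * (delta * A) = 11 / 48 * (1 / r) * A.
    by rewrite /delta; field; rewrite gt_eqF.
  rewrite ler_wpM2r// ler_pM2r ?divr_gt0// ler_pdivrMr ?mulr_gt0//; lra.
apply: le_ereal_sup_tmp; exists (ereal_inf [set worst_excess_risk X gamma bool xhat |
  xhat in estimator_rule (k := k) gamma bool]); first by exists _, bool.
apply: le_ereal_inf_tmp => _ [xhat _ <-].
pose M v := coin_mean (coin_bias delta v) (fun s => clip g a (xhat (observed (coin_loss g a) s))).
have worst v : ((delta * A - pm v * delta * M v)%:E <= worst_excess_risk X gamma bool xhat)%E.
  apply: (le_trans (coin_excess_risk_ge Xa XNa A0 delta01 v xhat)).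
  apply: ereal_sup_ubound; exists (coin_loss g a), (bernoulli_prob (coin_bias delta v)).
  split=> //; first exact: coin_loss_class.
  by move=> x; exact: coin_loss_integrable.
have diff : M true - M false <= 13 / 12 * A.
  have := @coin_mean_difference R delta A 1 1 k
    (fun s => clip g a (xhat (observed (coin_loss g a) s))) (fun s => clip_le A0 _).
  rewrite !mul1r !mulr1 expr1n.
  have -> : (1 + delta) / 2 = coin_bias delta true by rewrite /coin_bias /pm mul1r.
  have -> : (1 - delta) / 2 = coin_bias delta false by rewrite /coin_bias /pm mulN1r.
  rewrite -/(M true) -/(M false) => h.
  have : (M true - M false) ^+ 2 <= (13 / 12 * A) ^+ 2.
    apply: (le_trans h); rewrite [leRHS]exprMn [leRHS]mulrC; apply: ler_wpM2l; first exact: sqr_ge0.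
    by rewrite [leRHS]expr2; lra.
  have A13 : 0 <= 13 / 12 * A by rewrite mulr_ge0.
  move=> h2; apply: (le_trans (ler_norm _)).
  by rewrite -(ger0_norm A13) -ler_sqr ?nnegrE// !real_normK ?num_real.
(* The average of the two lower bounds is at least [delta * A * (1 - 13 / 24)]. *)
apply: (@le_trans _ _ (11 / 24 * (delta * A))%:E); first by rewrite lee_fin.
have := worst true; have := worst false.
case: (worst_excess_risk X gamma bool xhat) => [W| |]; rewrite ?leey ?leeNy_eq//.
rewrite !lee_fin /pm => h1 h2.
have := ler_wpM2l (ltW delta0) diff; lra.
Qed.

Lemma minimax_stochastic_risk_ge {R : realType} {n : nat}
    (gamma : 'rV[R]_n -> R) (X : set 'rV[R]_n) (k : nat) :
  is_norm gamma -> X !=set0 -> orthosymmetric X -> (0 < k)%N ->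
  ((1 / (8 * Num.sqrt (ln 3)) * (1 / Num.sqrt k%:R) * dual_radius gamma X)%:E <=
    minimax_stochastic_risk k X gamma)%E.
Proof.
move=> gamma_norm X0 symX k0.
have X_opp x : X x -> X (- x).
  move=> /(symX (fun=> true)); rewrite (_ : flip_signs _ x = - x)//.
  by apply/rowP => j; rewrite !mxE expr1 mulN1r.
set c := 1 / _ * _.
have c0 : 0 < c.
  have l3 := ln3_ge R.
  by rewrite mulr_gt0 ?divr_gt0 ?mulr_gt0 ?sqrtr_gt0 ?ltr0n//; lra.
have dotp_case x g : X x -> gamma g <= 1 ->
    ((c * dotp g x)%:E <= minimax_stochastic_risk k X gamma)%E.
  move=> Xx g1; have [gx|gx] := leP 0 (dotp g x).
    by apply: stochastic_risk_ge_dotp => //; exact: X_opp.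
  apply: (@le_trans _ _ (c * dotp g (- x))%:E).
    by rewrite lee_fin ler_pM2l// dotpNr; lra.
  apply: stochastic_risk_ge_dotp => //; rewrite ?opprK//; first exact: X_opp.
  by rewrite dotpNr; lra.
case: (minimax_stochastic_risk k X gamma) dotp_case => [r| |] h; rewrite ?leey//.
  rewrite lee_fin mulrC -ler_pdivlMr//; apply: dual_radius_le => // x g Xx g1.
  by rewrite ler_pdivlMr// mulrC -lee_fin; exact: h.
have [x Xx] := X0; have := h x 0 Xx; rewrite norm_zero// => /(_ ler01).
by rewrite leeNy_eq.
Qed.

(** * The minimax rates *)

Theorem theorem1 (R : realType) (n : nat) (gamma : 'rV[R]_n -> R)
    (X : set 'rV[R]_n)
    (gamma_norm : is_norm gamma)
    (gamma_orthosymmetric : orthosymmetric_norm gamma)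
    (gamma_qconvex : quadratically_convex_norm gamma)
    (X_nonempty : X !=set0)
    (X_convex : convex_subset X)
    (X_qconvex : quadratically_convex X)
    (X_orthosymmetric : orthosymmetric X)
    (X_compact : compact X)
    (k : nat) (k_ge1 : (1 <= k)%N) :
  [/\ ((1 / (8 * Num.sqrt (ln 3)) * (1 / Num.sqrt k%:R)
         * dual_radius gamma X)%:E
        <= minimax_stochastic_risk k X gamma)%E,
      (minimax_stochastic_risk k X gamma <= minimax_regret k X gamma)%E,
      (minimax_regret k X gamma
        <= (1 / Num.sqrt k%:R * dual_radius gamma X)%:E)%E &
      X° !=set0 ->
      exists lambda : 'rV[R]_n, (forall j, 0 < lambda 0 j) /\
        forall (d : measure_display) (S : measurableType d)
               (F : 'rV[R]_n -> S -> R) (s : k.-tuple S)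
               (x g : nat -> 'rV[R]_n),
          loss_class gamma F ->
          scaled_gradient_run lambda (fun i : 'I_k => F^~ (tnth s i)) x g ->
          (average_regret X (fun i : 'I_k => F^~ (tnth s i)) (fun i => x i)
            <= (1 / Num.sqrt k%:R * dual_radius gamma X)%:E)%E].
Proof.
split.
- exact: minimax_stochastic_risk_ge.
- exact: minimax_stochastic_le_regret.
- exact: minimax_regret_le.
- move=> X_body; have [lambda [lambda0 regret]] := scaled_gradient_regret
    gamma_norm gamma_orthosymmetric gamma_qconvex X_nonempty X_qconvex
    X_compact k_ge1 X_body.
  exists lambda; split=> // d S F s x g F_loss run.
  apply: regret run => i; have [F_admissible _] := (loss_classP gamma F).1 F_loss.
  exact: F_admissible.
Qed.
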